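(* Consider a network of $N$ agents running the quantized decentralized strategy (Q) described in the context, under the assumptions listed there (costs, gradient noise, quantization mechanism, combination matrix $\mathcal A$ and mixing parameter $\gamma$). Assume that each agent $k$ employs the randomized quantizer of the context built from the non-linearities $$g(t)=\mathrm{sign}(t)\,\frac{\ln\left(1+\frac{\omega_k}{\eta_k}|t|\right)}{2\ln\left(\omega_k+\sqrt{1+\omega_k^2}\right)},\qquad h(t)=\mathrm{sign}(t)\,\frac{\eta_k}{\omega_k}\left[\left(\omega_k+\sqrt{1+\omega_k^2}\right)^{2|t|}-1\right],$$ with parameters $\omega_k$ and $\eta_k$ scaling according to $$\omega_k=c,\qquad\eta_k\propto\mu,$$ where $c>0$ is a constant independent of the step-size $\mu$ and $\propto$ hides a (positive) proportionality constant independent of $\mu$. Then: 1. $\sigma_{q,k}^2\propto\mu^2$, where $\sigma_{q,k}^2$ is the absolute quantization noise parameter of agent $k$'s quantizer (see context). 2. In steady-state, the average number of bits at agent $k$ stays bounded as $\mu\to0$, namely $$\limsup_{i\to\infty}r_{k,i}=O(1),$$ i.e. there are constants $C,\mu_0>0$ independent of $\mu$ such that $\limsup_{i\to\infty}r_{k,i}\le C$ for all $0<\mu\le\mu_0$, where $r_{k,i}$ is the expected bit rate of agent $k$ at iteration $i$ defined in the context.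
   Context: **Notation.** Random quantities are in boldface. $\rho(\cdot)$ is the spectral radius; $\|\cdot\|$ is the Euclidean norm of vectors and the induced $2$-norm of matrices; $\mathrm{col}\{\cdot\}$ stacks vectors; $\mathrm{diag}\{\cdot\}$ forms a block diagonal matrix; $[x]_j$ or $x_j$ is the $j$-th entry of $x$; $\lfloor\cdot\rfloor$, $\lceil\cdot\rceil$ are floor and ceiling. **Problem.** Agent $k\in\{1,\dots,N\}$ has a cost $J_k:\mathbb R^{M_k}\to\mathbb R$ and a neighborhood $\mathcal N_k$ (with $k\in\mathcal N_k$). Let $M=\sum_kM_k$. $\mathcal U$ is a real $M\times P$ matrix ($P\ll M$) with $\mathcal U^\top\mathcal U=I_P$. The vector $w^o=\mathrm{col}\{w_1^o,\dots,w_N^o\}$, $w_k^o\in\mathbb R^{M_k}$, is the (unique) minimizer of $\sum_{k=1}^NJ_k(w_k)$ over $\mathrm{col}\{w_1,\dots,w_N\}\in\mathrm{Range}(\mathcal U)$. $\mathcal A$ is the real $N\times N$ block matrix with $(k,\ell)$ block $A_{k\ell}\in\mathbb R^{M_k\times M_\ell}$, with $A_{k\ell}=0$ if $\ell\notin\mathcal N_k$, and it satisfies $\mathcal A\,\mathcal U=\mathcal U$, $\mathcal U^\top\mathcal A=\mathcal U^\top$, $\rho(\mathcal A-\mathcal U\mathcal U^\top)<1$. **Strategy (Q).** With step-size $\mu>0$ and mixing parameter $\gamma\in(0,1]$, for $i\ge1$ and every $k$: $$\boldsymbol\psi_{k,i}=\boldsymbol w_{k,i-1}-\mu\,\widehat{\nabla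 J_k}(\boldsymbol w_{k,i-1}),$$ $$\boldsymbol\phi_{k,i}=\boldsymbol\phi_{k,i-1}+\boldsymbol{\mathcal Q}_k(\boldsymbol\psi_{k,i}-\boldsymbol\phi_{k,i-1}),$$ $$\boldsymbol w_{k,i}=(1-\gamma)\boldsymbol\phi_{k,i}+\gamma\sum_{\ell\in\mathcal N_k}A_{k\ell}\boldsymbol\phi_{\ell,i},$$ where $\widehat{\nabla J_k}$ is a stochastic approximation (at iteration $i$) of the gradient $\nabla J_k$ and $\boldsymbol{\mathcal Q}_k$ is a randomized quantizer on $\mathbb R^{M_k}$. The initial vectors $\boldsymbol\phi_{k,0}$ have finite second moments, and $\boldsymbol w_{k,0}$ is given by the third equation with $i=0$. Write $\boldsymbol\chi_{k,i}=\boldsymbol\psi_{k,i}-\boldsymbol\phi_{k,i-1}$ for the quantizer input. **Assumption on the costs.** The $J_k$ are twice differentiable and convex with $\lambda_{k,\min}I_{M_k}\le\nabla^2J_k(w_k)\le\lambda_{k,\max}I_{M_k}$, $\lambda_{k,\min}\ge0$, for all $w_k$; and for some $0<\lambda_{\min}\le\lambda_{\max}$ and all $\{w_k\}$, $$0<\lambda_{\min}I_P\le\mathcal U^\top\mathrm{diag}\{\nabla^2J_k(w_k)\}_{k=1}^N\,\mathcal U\le\lambda_{\max}I_P.$$ **Assumption on the gradient noise.** Let $\boldsymbol s_{k,i}(w_k)=\nabla J_k(w_k)-\widehat{\nabla J_k}(w_k)$. For each $k$ there are $\beta_{s,k}^2,\sigma_{s,k}^2\ge0$ with $$\mathbb E[\boldsymbol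 s_{k,i}(\boldsymbol w_{k,i-1})\mid\{\boldsymbol\phi_{\ell,i-1}\}_{\ell=1}^N]=0,$$ $$\mathbb E[\|\boldsymbol s_{k,i}(\boldsymbol w_{k,i-1})\|^2\mid\{\boldsymbol\phi_{\ell,i-1}\}_{\ell=1}^N]\le\beta_{s,k}^2\|w_k^o-\boldsymbol w_{k,i-1}\|^2+\sigma_{s,k}^2.$$ **Quantizer.** Given a strictly increasing continuous $g:\mathbb R\to\mathbb R$ with inverse $h=g^{-1}$, the randomized quantizer acts entrywise: $[\boldsymbol{\mathcal Q}(x)]_j=y_{\boldsymbol n(x_j)}$, where $y_m=h(m)$ for integers $m$ and, with $m=\lfloor g(x_j)\rfloor$, the random index $\boldsymbol n(x_j)$ equals $m$ with probability $\frac{y_{m+1}-x_j}{y_{m+1}-y_m}$ and $m+1$ with probability $\frac{x_j-y_m}{y_{m+1}-y_m}$. For the non-linearities $g,h$ of the claim with parameters $(\omega_k,\eta_k)$ and dimension $M_k$, the quantizer is unbiased, $\mathbb E[\boldsymbol{\mathcal Q}_k(x)]=x$, and satisfies $\mathbb E\|x-\boldsymbol{\mathcal Q}_k(x)\|^2\le(\omega_k\|x\|+\sqrt{M_k}\,\eta_k)^2\le\beta_{q,k}^2\|x\|^2+\sigma_{q,k}^2$ with the noise parameters $$\beta_{q,k}^2=\frac{\omega_k^2}{\alpha},\qquad\sigma_{q,k}^2=\frac{M_k\eta_k^2}{1-\alpha},$$ for any $\alpha\in(0,1)$; fix one such $\alpha$, independent of $\mu$. **Quantization mechanism.** Given the past,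 the quantization randomness depends only on the quantizer input: with $\boldsymbol h_i$ collecting $\{\{\boldsymbol\phi_{\ell,j}\}_{j=0}^{i-1},\{\boldsymbol\psi_{\ell,j}\}_{j=1}^{i}\}_{\ell=1}^N$, $$\mathbb E[\boldsymbol\chi_{k,i}-\boldsymbol{\mathcal Q}_k(\boldsymbol\chi_{k,i})\mid\boldsymbol h_i]=\mathbb E[\boldsymbol\chi_{k,i}-\boldsymbol{\mathcal Q}_k(\boldsymbol\chi_{k,i})\mid\boldsymbol\chi_{k,i}]=0,$$ $$\mathbb E[\|\boldsymbol\chi_{k,i}-\boldsymbol{\mathcal Q}_k(\boldsymbol\chi_{k,i})\|^2\mid\boldsymbol h_i]=\mathbb E[\|\boldsymbol\chi_{k,i}-\boldsymbol{\mathcal Q}_k(\boldsymbol\chi_{k,i})\|^2\mid\boldsymbol\chi_{k,i}]\le\beta_{q,k}^2\|\boldsymbol\chi_{k,i}\|^2+\sigma_{q,k}^2.$$ **Jordan decomposition and condition on $\gamma$.** $\mathcal A$ can be written $\mathcal A=\mathcal V_\epsilon\Lambda_\epsilon\mathcal V_\epsilon^{-1}$ with $$\mathcal V_\epsilon=[\,\mathcal U\mid\mathcal V_{R,\epsilon}\,],\quad\Lambda_\epsilon=\begin{bmatrix}I_P&0\\0&\mathcal J_\epsilon\end{bmatrix},\quad\mathcal V_\epsilon^{-1}=\begin{bmatrix}\mathcal U^\top\\\mathcal V_{L,\epsilon}^\top\end{bmatrix},$$ where $\mathcal J_\epsilon$ is a Jordan matrix with the eigenvalues (possibly complex, of magnitude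 less than one) on the diagonal and $\epsilon>0$ on the super-diagonal, $\epsilon$ being fixed small enough that $\rho(\mathcal J_\epsilon)+\epsilon\in(0,1)$. With $v_1=\|\mathcal V_\epsilon^{-1}\|$, $v_2=\|\mathcal V_\epsilon\|$, $\beta_{q,\max}^2=\max_k\beta_{q,k}^2$, the mixing parameter $\gamma$ (independent of $\mu$) satisfies $$0<\gamma<\min\left\{1,\ \frac{1-(\rho(\mathcal J_\epsilon)+\epsilon)}{4v_1^2v_2^2\,\beta_{q,\max}^2\,(\rho(I-\mathcal J_\epsilon)+\epsilon)^2}\right\}.$$ **Bit rate.** Under the variable-rate coding scheme used, encoding an integer $n$ takes $\log_2(3)\,(1+\lceil\log_2(|n|+1)\rceil)$ bits, and the expected bit rate at agent $k$ and iteration $i$ is $$r_{k,i}=\log_2(3)\sum_{j=1}^{M_k}\left(1+\mathbb E\left[\left\lceil\log_2\left(|\boldsymbol n([\boldsymbol\chi_{k,i}]_j)|+1\right)\right\rceil\right]\right).$$ *)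

(* Defs.v *)
From HB Require Import structures.
From mathcomp Require Import all_boot all_order all_algebra.
From mathcomp Require Import all_classical all_reals all_analysis.
From mathcomp Require Import measurable_realfun lebesgue_measure complex.

Set Implicit Arguments.
Unset Strict Implicit.
Unset Printing Implicit Defensive.
Import Order.TTheory GRing.Theory Num.Theory.
Import numFieldNormedType.Exports.
Local Open Scope classical_set_scope.
Local Open Scope ring_scope.

Section LinearAlgebra.
Variable R : realType.
Local Notation C := (complex R).

(* The library norm `|x| on matrices is the sup norm. *)
Definition norm2 n (x : 'cV[R]_n) : R := Num.sqrt (\sum_i x i 0 ^+ 2).

Definition cnorm2 n (x : 'cV[C]_n) : R :=
  Num.sqrt (\sum_i ComplexField.Normc.normc (x i 0) ^+ 2).

Definition opnorm2 m n (B : 'M[C]_(m, n)) : R :=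
  sup [set cnorm2 (B *m x) | x in [set x : 'cV[C]_n | cnorm2 x <= 1]].

Definition spectral_radius n (B : 'M[C]_n) : R :=
  sup [set ComplexField.Normc.normc a | a in [set a : C | eigenvalue B a]].

Definition mxC m n (B : 'M[R]_(m, n)) : 'M[C]_(m, n) :=
  map_mx (fun x : R => real_complex R x) B.

(* Symmetry is part of the Loewner order; for the Hessians below it holds
   automatically, by twice differentiability. *)
Definition psd n (B : 'M[R]_n) : Prop :=
  B^T = B /\ forall x : 'cV[R]_n, 0 <= (x^T *m B *m x) 0 0.

Definition loewner_le n (A B : 'M[R]_n) : Prop := psd (B - A).

Definition in_range m n (U : 'M[R]_(m, n)) (w : 'cV[R]_m) : Prop :=
  exists x : 'cV[R]_n, w = U *m x.

(* eps replaces the usual 1 on the super-diagonal. *)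
Definition jordan_block (eps : R) (lam : C) n : 'M[C]_n :=
  \matrix_(i < n, j < n)
    if i == j then lam
    else if j == i.+1 :> nat then real_complex R eps else 0.

Definition jordan_mx (eps : R) B (lam : 'I_B -> C) (sz : 'I_B -> nat) :
    'M[C]_(\sum_b sz b) :=
  \mxdiag_b jordan_block eps (lam b) (sz b).

End LinearAlgebra.

Section Calculus.
Variables (R : realType) (n : nat).
Implicit Type f : 'cV[R]_n -> R.

Definition grad f (x : 'cV[R]_n) : 'cV[R]_n :=
  \col_j 'D_(delta_mx j 0) f x.

Definition hess f (x : 'cV[R]_n) : 'M[R]_n :=
  \matrix_(i, j) ('D_(delta_mx j 0) (grad f) x) i 0.

Definition twice_differentiable f : Prop :=
  (forall x, differentiable f x) /\ (forall x, differentiable (grad f) x).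

End Calculus.

Section CostsAndCombination.
Variables (R : realType) (N P : nat) (M : 'I_N -> nat).
Variable J : forall k : 'I_N, 'cV[R]_(M k) -> R.
Variable U : 'M[R]_(\sum_k M k, P).

Definition aggregate_cost (w : 'cV[R]_(\sum_k M k)) : R :=
  \sum_k J (submxcol w k).

Definition is_minimizer (w : 'cV[R]_(\sum_k M k)) : Prop :=
  in_range U w /\ forall w', in_range U w' -> aggregate_cost w <= aggregate_cost w'.

Definition is_unique_minimizer (w : 'cV[R]_(\sum_k M k)) : Prop :=
  is_minimizer w /\ forall w', is_minimizer w' -> w' = w.

Record cost_assumption (lk_min lk_max : 'I_N -> R) (l_min l_max : R) : Prop :=
  CostAssumption {
  cost_twice_diff : forall k, twice_differentiable (@J k) ;
  cost_convex : forall k,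
    convex_function (setT : set (convex_lmodType 'cV[R]_(M k))) (@J k) ;
  cost_local_ge0 : forall k, 0 <= lk_min k ;
  cost_local_hess : forall k (w : 'cV[R]_(M k)),
    loewner_le (lk_min k)%:M (hess (@J k) w) /\
    loewner_le (hess (@J k) w) (lk_max k)%:M ;
  cost_global_gt0 : 0 < l_min <= l_max ;
  cost_global_hess : forall w : forall k, 'cV[R]_(M k),
    let H := U^T *m (\mxdiag_k hess (@J k) (w k)) *m U in
    loewner_le l_min%:M H /\ loewner_le H l_max%:M }.

Record combination_assumption (Nb : 'I_N -> {set 'I_N})
    (A : 'M[R]_(\sum_k M k)) : Prop := CombinationAssumption {
  comb_self : forall k, k \in Nb k ;
  comb_sparse : forall k l, l \notin Nb k -> submxblock A k l = 0 ;
  comb_orth : U^T *m U = 1%:M ;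
  comb_right : A *m U = U ;
  comb_left : U^T *m A = U^T ;
  comb_radius : spectral_radius (mxC (A - U *m U^T)) < 1 }.

Section Jordan.
Variables (B : nat) (lam : 'I_B -> complex R) (sz : 'I_B -> nat).
Variables (VR VL : 'M[complex R]_(\sum_k M k, \sum_b sz b)).

Definition V_eps : 'M[complex R]_(\sum_k M k, P + \sum_b sz b) :=
  row_mx (mxC U) VR.

Definition Vinv_eps : 'M[complex R]_(P + \sum_b sz b, \sum_k M k) :=
  col_mx (mxC U^T) VL^T.

(* B is the number of Jordan blocks. The two inverse equations force
   P + \sum_b sz b to be the ambient dimension \sum_k M k. *)
Record jordan_decomposition (eps : R) (A : 'M[R]_(\sum_k M k)) : Prop :=
  JordanDecomposition {
  jd_eps : 0 < eps ;
  jd_size : forall b, (0 < sz b)%N ;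
  jd_lam : forall b, ComplexField.Normc.normc (lam b) < 1 ;
  jd_radius : 0 < spectral_radius (jordan_mx eps lam sz) + eps < 1 ;
  jd_VVinv : V_eps *m Vinv_eps = 1%:M ;
  jd_VinvV : Vinv_eps *m V_eps = 1%:M ;
  jd_A : mxC A =
    V_eps *m block_mx 1%:M 0 0 (jordan_mx eps lam sz) *m Vinv_eps }.

Definition gamma_bound (eps bq2_max : R) : R :=
  let v1 := opnorm2 Vinv_eps in
  let v2 := opnorm2 V_eps in
  let Je := jordan_mx eps lam sz in
  Num.min 1
    ((1 - (spectral_radius Je + eps)) /
     (4 * v1 ^+ 2 * v2 ^+ 2 * bq2_max *
      (spectral_radius (1%:M - Je) + eps) ^+ 2)).

End Jordan.
End CostsAndCombination.

Section Quantizer.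
Variable R : realType.

Definition nl_g (omega eta t : R) : R :=
  Num.sg t * (ln (1 + omega / eta * `|t|) /
              (2 * ln (omega + Num.sqrt (1 + omega ^+ 2)))).

Definition nl_h (omega eta t : R) : R :=
  Num.sg t * (eta / omega *
    ((omega + Num.sqrt (1 + omega ^+ 2)) `^ (2 * `|t|) - 1)).

Definition qlevel (h : R -> R) (m : int) : R := h m%:~R.

Definition prob_down (h : R -> R) (m : int) (x : R) : R :=
  (qlevel h (m + 1) - x) / (qlevel h (m + 1) - qlevel h m).

Definition prob_up (h : R -> R) (m : int) (x : R) : R :=
  (x - qlevel h m) / (qlevel h (m + 1) - qlevel h m).

Definition beta_q2 (alpha omega : R) : R := omega ^+ 2 / alpha.

Definition sigma_q2 (alpha : R) (m : nat) (eta : R) : R :=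
  m%:R * eta ^+ 2 / (1 - alpha).

Definition log2 (x : R) : R := ln x / ln 2.

Definition propto (f f' : R -> R) : Prop :=
  exists2 K : R, 0 < K & forall mu, 0 < mu -> f mu = K * f' mu.

End Quantizer.

Section Conditioning.
Context {R : realType} {d : measure_display} {T : measurableType d}.
Variable Pr : probability T R.

Definition sigma_of (F : set (T -> R)) : set (set T) :=
  <<s \bigcup_(f in F) preimage_set_system setT f measurable >>.

(* The Borel sigma-algebra of R^n being generated by the coordinates,
   sigma_of (entries X) is the sigma-algebra generated by X. *)
Definition entries n (X : T -> 'cV[R]_n) : set (T -> R) :=
  [set (fun t => X t j 0) | j in [set: 'I_n]].

(* [is_cond_exp G X Y]: Y is a version of E[X | G]. As usual X is either
   integrable or nonnegative (then Y may take the value +oo). *)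
Definition is_cond_exp (G : set (set T)) (X Y : T -> \bar R) : Prop :=
  [/\ Pr.-integrable setT X \/
        (measurable_fun setT X /\ forall t, (0 <= X t)%E),
      forall B : set (\bar R), measurable B -> G (Y @^-1` B) &
      forall E, G E ->
        (\int[Pr]_(t in E) Y t = \int[Pr]_(t in E) X t)%E].

Definition has_cond_prob (G : set (set T)) (E : set T) (p : T -> R) : Prop :=
  is_cond_exp G (fun t => (\1_E t)%:E) (fun t => (p t)%:E).

End Conditioning.

(* The processes are indexed by the iteration i; psi, ghat and idx are
   meaningful for i >= 1 only. [ghat k i t] is the random field approximating
   grad J_k at iteration i, and [idx k i j] is the random index
   n([chi_{k,i}]_j) drawn by the quantizer. *)
Record trajectory (R : realType) (N : nat) (M : 'I_N -> nat) (T : Type) :=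
  Trajectory {
  phi : forall k : 'I_N, nat -> T -> 'cV[R]_(M k) ;
  psi : forall k : 'I_N, nat -> T -> 'cV[R]_(M k) ;
  wgt : forall k : 'I_N, nat -> T -> 'cV[R]_(M k) ;
  ghat : forall k : 'I_N, nat -> T -> 'cV[R]_(M k) -> 'cV[R]_(M k) ;
  idx : forall k : 'I_N, nat -> 'I_(M k) -> T -> int }.

Section Strategy.
Context {R : realType} {d : measure_display} {T : measurableType d}.
Variable Pr : probability T R.
Variables (N : nat) (M : 'I_N -> nat).
Variable J : forall k : 'I_N, 'cV[R]_(M k) -> R.
Variables (Nb : 'I_N -> {set 'I_N}) (A : 'M[R]_(\sum_k M k)).
Variable wo : 'cV[R]_(\sum_k M k).
Variable X : trajectory R M T.

Definition chi k i t : 'cV[R]_(M k) := psi X k i t - phi X k i.-1 t.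

Definition quantized (h : 'I_N -> R -> R) k i t : 'cV[R]_(M k) :=
  \col_j qlevel (h k) (idx X i j t).

Definition quant_error h k i t : 'cV[R]_(M k) := chi k i t - quantized h k i t.

Definition grad_noise k i t : 'cV[R]_(M k) :=
  grad (@J k) (wgt X k i.-1 t) - ghat X i t (wgt X k i.-1 t).

Definition sigma_phi i : set (set T) :=
  sigma_of (\bigcup_l entries (phi X l i)).

Definition sigma_hist i : set (set T) :=
  sigma_of (\bigcup_l
    ((\bigcup_(j in [set j | (j < i)%N]) entries (phi X l j)) `|`
     (\bigcup_(j in [set j | (1 <= j <= i)%N]) entries (psi X l j)))).

Definition sigma_chi k i : set (set T) := sigma_of (entries (chi k i)).

Record strategyQ (mu gamma : R) (h : 'I_N -> R -> R) : Prop := StrategyQ {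
  strat_psi : forall k i t, (1 <= i)%N ->
    psi X k i t = wgt X k i.-1 t - mu *: ghat X i t (wgt X k i.-1 t) ;
  strat_phi : forall k i t, (1 <= i)%N ->
    phi X k i t = phi X k i.-1 t + quantized h k i t ;
  strat_wgt : forall k i t,
    wgt X k i t = (1 - gamma) *: phi X k i t
      + gamma *: (\sum_(l in Nb k) submxblock A k l *m phi X l i t) ;
  strat_ghat_meas : forall k i (j : 'I_(M k)), (1 <= i)%N ->
    measurable_fun setT (fun t => ghat X i t (wgt X k i.-1 t) j 0) ;
  strat_phi0_meas : forall k (j : 'I_(M k)),
    measurable_fun setT (fun t => phi X k 0%N t j 0) ;
  strat_phi0_moment : forall k,
    Pr.-integrable setT (fun t => (norm2 (phi X k 0%N t) ^+ 2)%:E) }.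

Record gradient_noise_assumption (bs2 ss2 : 'I_N -> R) : Prop :=
  GradientNoiseAssumption {
  gn_ge0 : forall k, 0 <= bs2 k /\ 0 <= ss2 k ;
  gn_mean : forall k i (j : 'I_(M k)), (1 <= i)%N ->
    is_cond_exp Pr (sigma_phi i.-1) (fun t => (grad_noise k i t j 0)%:E)
      (cst 0%E) ;
  gn_var : forall k i, (1 <= i)%N ->
    exists2 Y : T -> \bar R,
      is_cond_exp Pr (sigma_phi i.-1)
        (fun t => (norm2 (grad_noise k i t) ^+ 2)%:E) Y &
      {ae Pr, forall t, (Y t <=
        (bs2 k * norm2 (submxcol wo k - wgt X k i.-1 t) ^+ 2 + ss2 k)%:E)%E} }.

(* The quantizer applied to a random input: the distribution of its index is
   prescribed conditionally on that input. *)
Record randomized_quantizer (g h : 'I_N -> R -> R) : Prop :=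
  RandomizedQuantizer {
  rq_meas : forall k i (j : 'I_(M k)) (z : int), (1 <= i)%N ->
    measurable [set t | idx X i j t = z] ;
  rq_down : forall k i (j : 'I_(M k)), (1 <= i)%N ->
    let x t := chi k i t j 0 in
    let m t := Num.floor (g k (x t)) in
    has_cond_prob Pr (sigma_chi k i) [set t | idx X i j t = m t]
      (fun t => prob_down (h k) (m t) (x t)) ;
  rq_up : forall k i (j : 'I_(M k)), (1 <= i)%N ->
    let x t := chi k i t j 0 in
    let m t := Num.floor (g k (x t)) in
    has_cond_prob Pr (sigma_chi k i) [set t | idx X i j t = m t + 1]
      (fun t => prob_up (h k) (m t) (x t)) }.

Record quantization_mechanism (h : 'I_N -> R -> R) (bq2 sq2 : 'I_N -> R) :
    Prop := QuantizationMechanism {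
  qm_mean : forall k i (j : 'I_(M k)), (1 <= i)%N ->
    is_cond_exp Pr (sigma_hist i) (fun t => (quant_error h k i t j 0)%:E)
      (cst 0%E) /\
    is_cond_exp Pr (sigma_chi k i) (fun t => (quant_error h k i t j 0)%:E)
      (cst 0%E) ;
  qm_var : forall k i, (1 <= i)%N ->
    exists Y : T -> \bar R,
    [/\ is_cond_exp Pr (sigma_hist i)
          (fun t => (norm2 (quant_error h k i t) ^+ 2)%:E) Y,
        is_cond_exp Pr (sigma_chi k i)
          (fun t => (norm2 (quant_error h k i t) ^+ 2)%:E) Y &
        {ae Pr, forall t, (Y t <=
          (bq2 k * norm2 (chi k i t) ^+ 2 + sq2 k)%:E)%E}] }.

Definition bit_rate k i : \bar R :=
  ((log2 3)%:E * \sum_(j < M k)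
    (1 + 'E_Pr[fun t =>
            (Num.ceil (log2 (`|idx X i j t|%N%:R + 1 : R)))%:~R])%E)%E.

End Strategy.

(* Main.v *)
Require Import Defs.
From HB Require Import structures.
From mathcomp Require Import all_boot all_order all_algebra.
From mathcomp Require Import all_classical all_reals all_analysis.
From mathcomp Require Import measurable_realfun lebesgue_measure complex.
From mathcomp Require Import ring lra.
Import Order.TTheory GRing.Theory Num.Theory.
Import numFieldNormedType.Exports.
Local Open Scope classical_set_scope.
Local Open Scope ring_scope.

(** Part 1 is a computation: [sigma_q2] is quadratic in [eta], which is proportional
to [mu].

Part 2 rests on one fact: in steady state the quantizer input has a second moment of
order [mu ^+ 2], the square of the resolution [eta] of the quantizer.  The levels of the
quantizer grow at least linearly in the index, with slope proportional to [eta]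
([qlevel_growth]), so the expected index is at most a constant plus a constant times
the second moment of the output divided by [eta ^+ 2]; and a code length is at most
linear in the index ([code_length_le]).  The bit rate is therefore bounded uniformly in
[mu] ([bit_rate_le]).

For the second moment, stack the agents, let [x := wo - phi] be the error and
[W := (1 - gamma) I + gamma A] the mixing matrix.  As [W] fixes [wo], one iteration reads
[x' = W x + mu g + z], where [g] is the stochastic gradient and [z] the quantization error,
and the quantizer input is [x - W x - mu g].  Two components of [x] are followed: the
centroid [U^T x], left unchanged by [W], and the disagreement [VL^T x], on which [W] acts as
[(1 - gamma) I + gamma J].  A Jordan matrix with [eps] above the diagonal has norm at most
its spectral radius plus [eps] ([csq_jordan]), so mixing contracts the disagreement.
Since [I - W] vanishes on the range of [U], the quantizer input is controlled by the
disagreement up to [mu g], and the condition on [gamma] says that the quantization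
noise fed back into the disagreement uses up at most half of the contraction
([mixing_estimates]).  The centroid contracts by [1 - mu * l_min] because the
aggregate gradient is strongly monotone along the range of [U] ([drift_estimates]).

The cross terms vanish in expectation: the gradient noise is uncorrelated with [phi]
and the quantization error with [psi] ([cond_zero_orthogonal]).  The second moments [a] of the
centroid and [b] of the disagreement thus satisfy, for a constant [D] and a rate [dl]
independent of [mu],

    [b' <= (1 - dl) b + D mu^2 (1 + a + b)],
    [a' <= (1 - mu l) a + D b + D mu + D mu^2 (1 + a + b)].

A weighted sum of [a] and [b] contracts at rate [mu] under a forcing of order [mu], hence
is eventually bounded; the first inequality alone then brings [b] down to order
[mu ^+ 2] ([two_timescale]).  The quantizer input follows. *)

Set Implicit Arguments.
Unset Strict Implicit.
Unset Printing Implicit Defensive.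

(** * Euclidean norms, real and complex *)

Section SquaredNorm.
Variable R : realType.
Implicit Types (n : nat).

Definition dotv n (x y : 'cV[R]_n) : R := \sum_i x i 0 * y i 0.
Definition sqn n (x : 'cV[R]_n) : R := \sum_i x i 0 ^+ 2.

Lemma dotvv n (x : 'cV[R]_n) : dotv x x = sqn x.
Proof. by apply: eq_bigr => i _; rewrite expr2. Qed.

Lemma sqn_ge0 n (x : 'cV[R]_n) : 0 <= sqn x.
Proof. by apply: sumr_ge0 => i _; rewrite sqr_ge0. Qed.

Lemma norm2_sqr n (x : 'cV[R]_n) : norm2 x ^+ 2 = sqn x.
Proof. by rewrite sqr_sqrtr // sqn_ge0. Qed.

Lemma sqnD n (x y : 'cV[R]_n) : sqn (x + y) = sqn x + dotv x y *+ 2 + sqn y.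
Proof.
rewrite /sqn /dotv -sumrMnl -!big_split /=; apply: eq_bigr => i _.
by rewrite !mxE sqrrD.
Qed.

Lemma sqnZ n (a : R) (x : 'cV[R]_n) : sqn (a *: x) = a ^+ 2 * sqn x.
Proof. by rewrite mulr_sumr; apply: eq_bigr => i _; rewrite !mxE exprMn. Qed.

Lemma sqnN n (x : 'cV[R]_n) : sqn (- x) = sqn x.
Proof. by apply: eq_bigr => i _; rewrite !mxE sqrrN. Qed.

(** The weighted form of Young's inequality: a small [t] costs almost nothing on [x],
which preserves a contraction of [x] under a perturbation [y]. *)
Lemma sqn_young n (t : R) (x y : 'cV[R]_n) : 0 < t ->
  sqn (x + y) <= (1 + t) * sqn x + (1 + t^-1) * sqn y.
Proof.
move=> t0; rewrite /sqn !mulr_sumr -big_split /=; apply: ler_sum => i _.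
rewrite !mxE; set a := x i 0; set b := y i 0.
have e : 1 = t * t^-1 by rewrite divff ?gt_eqF.
have u0 : 0 < t^-1 by rewrite invr_gt0.
have : 0 <= t^-1 * (t * a - b) ^+ 2 by rewrite mulr_ge0 ?sqr_ge0 // ltW.
have -> : t^-1 * (t * a - b) ^+ 2 =
   (t * t^-1) * (t * a^+2) - (t * t^-1) * (a * b *+ 2) + t^-1 * b^+2 by ring.
by rewrite -e; nra.
Qed.

Lemma sqnD_le n (x y : 'cV[R]_n) : sqn (x + y) <= 2 * sqn x + 2 * sqn y.
Proof. by have := @sqn_young n 1 x y ltr01; rewrite invr1. Qed.

Lemma sqnB_le n (x y : 'cV[R]_n) : sqn (x - y) <= 2 * sqn x + 2 * sqn y.
Proof. by have := sqnD_le x (- y); rewrite sqnN. Qed.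

Lemma sqn_mxcol p (s : 'I_p -> nat) (F : forall k, 'cV[R]_(s k)) :
  sqn (\mxcol_k F k) = \sum_k sqn (F k).
Proof.
rewrite /sqn sig_big_dep/= (reindex _ tagnat.sig_bij_on)/=.
by apply: eq_bigr => i _; rewrite !mxE.
Qed.

Lemma dotv_mxcol p (s : 'I_p -> nat) (F G : forall k, 'cV[R]_(s k)) :
  dotv (\mxcol_k F k) (\mxcol_k G k) = \sum_k dotv (F k) (G k).
Proof.
rewrite /dotv sig_big_dep/= (reindex _ tagnat.sig_bij_on)/=.
by apply: eq_bigr => i _; rewrite !mxE.
Qed.

Lemma dotvC n (x y : 'cV[R]_n) : dotv x y = dotv y x.
Proof. by apply: eq_bigr => i _; rewrite mulrC. Qed.

Lemma dotvDr n (x y z : 'cV[R]_n) : dotv x (y + z) = dotv x y + dotv x z.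
Proof. by rewrite /dotv -big_split; apply: eq_bigr => i _; rewrite mxE mulrDr. Qed.

Lemma dotvZr n (a : R) (x y : 'cV[R]_n) : dotv x (a *: y) = a * dotv x y.
Proof. by rewrite /dotv mulr_sumr; apply: eq_bigr => i _; rewrite mxE mulrCA. Qed.

Lemma dotvBr n (x y z : 'cV[R]_n) : dotv x (y - z) = dotv x y - dotv x z.
Proof. by rewrite dotvDr -scaleN1r dotvZr mulN1r. Qed.

Lemma dotvBl n (x y z : 'cV[R]_n) : dotv (x - y) z = dotv x z - dotv y z.
Proof. by rewrite dotvC dotvBr !(dotvC z). Qed.

Lemma dotvZl n (a : R) (x y : 'cV[R]_n) : dotv (a *: x) y = a * dotv x y.
Proof. by rewrite dotvC dotvZr dotvC. Qed.

Lemma dotv_mx n (x y : 'cV[R]_n) : dotv x y = (x^T *m y) 0 0.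
Proof. by rewrite mxE; apply: eq_bigr => i _; rewrite mxE. Qed.

Lemma dotv_mulmxl m n (B : 'M[R]_(m, n)) x y : dotv (B *m x) y = dotv x (B^T *m y).
Proof. by rewrite !dotv_mx trmx_mul mulmxA. Qed.

Lemma dotv_young m (l : R) (x y : 'cV[R]_m) : 0 < l ->
  dotv x y *+ 2 <= l * sqn x + l^-1 * sqn y.
Proof.
move=> l0; have := sqn_ge0 (l *: x - y).
rewrite sqnD sqnZ sqnN -scaleN1r dotvZr dotvZl => h.
have h2 : 0 <= l^-1 * (l ^+ 2 * sqn x + (-1 * (l * dotv x y)) *+ 2 + sqn y).
  by rewrite mulr_ge0 // invr_ge0 ltW.
have e : l * l^-1 = 1 by rewrite divff ?gt_eqF.
move: h2; have -> : l^-1 * (l ^+ 2 * sqn x + (-1 * (l * dotv x y)) *+ 2 + sqn y) =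
  l * l^-1 * (l * sqn x - dotv x y *+ 2) + l^-1 * sqn y by ring.
by rewrite e; lra.
Qed.

End SquaredNorm.

Section ComplexSquaredNorm.
Variable R : realType.
Local Notation C := (complex R).
Local Notation normc := (@ComplexField.Normc.normc R).
Implicit Types (n : nat).

Definition csq n (x : 'cV[C]_n) : R := \sum_i normc (x i 0) ^+ 2.

Lemma normc_ge0 (z : C) : 0 <= normc z.
Proof. by case: z => a b; rewrite sqrtr_ge0. Qed.

Lemma normc_sqr (z : C) : normc z ^+ 2 = complex.Re z ^+ 2 + complex.Im z ^+ 2.
Proof. by case: z => a b /=; rewrite sqr_sqrtr // addr_ge0 ?sqr_ge0. Qed.

Lemma normcR (a : R) : 0 <= a -> normc (real_complex R a) = a.
Proof. by move=> a0 /=; rewrite expr0n /= addr0 sqrtr_sqr ger0_norm. Qed.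

Lemma csq_ge0 n (x : 'cV[C]_n) : 0 <= csq x.
Proof. by apply: sumr_ge0 => i _; rewrite sqr_ge0. Qed.

Lemma csq_mxcol p (s : 'I_p -> nat) (F : forall k, 'cV[C]_(s k)) :
  csq (\mxcol_k F k) = \sum_k csq (F k).
Proof.
rewrite /csq sig_big_dep/= (reindex _ tagnat.sig_bij_on)/=.
by apply: eq_bigr => i _; rewrite !mxE.
Qed.

Lemma csq_col_mx m n (x : 'cV[C]_m) (y : 'cV[C]_n) :
  csq (col_mx x y) = csq x + csq y.
Proof.
rewrite /csq big_split_ord /=; congr (_ + _); apply: eq_bigr => i _.
  by rewrite col_mxEu.
by rewrite col_mxEd.
Qed.

Lemma csq_real n (x : 'cV[R]_n) : csq (mxC x) = sqn x.
Proof.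
by apply: eq_bigr => i _; rewrite mxE normc_sqr /= expr0n /= addr0.
Qed.

(** The error process is real but the left Jordan vectors are complex.  Stacking
real and imaginary parts turns the squared norm of a complex image of a real
vector into the squared norm of a real image, so that all random quantities can
be kept real. *)
Definition realify m n (B : 'M[C]_(m, n)) : 'M[R]_(m + m, n) :=
  col_mx (map_mx (@complex.Re R) B) (map_mx (@complex.Im R) B).

Lemma sqn_realify m n (B : 'M[C]_(m, n)) (x : 'cV[R]_n) :
  sqn (realify B *m x) = csq (B *m mxC x).
Proof.
rewrite /csq; under [RHS]eq_bigr => i _ do rewrite normc_sqr.
rewrite big_split /= /sqn big_split_ord /=; congr (_ + _); apply: eq_bigr => i _;
  rewrite mul_col_mx ?col_mxEu ?col_mxEd !mxE; congr (_ ^+ 2);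
  [rewrite (raddf_sum (@complex.Re R))|rewrite (raddf_sum (@complex.Im R))];
  apply: eq_bigr => j _; rewrite !mxE; case: (B i j) => a b /=;
  by rewrite mulr0 ?mul0r ?subr0 ?addr0 ?add0r.
Qed.

Lemma cnorm2_sqr n (x : 'cV[C]_n) : cnorm2 x ^+ 2 = csq x.
Proof. by rewrite sqr_sqrtr // csq_ge0. Qed.

Lemma normc_entry_le n (x : 'cV[C]_n) i : normc (x i 0) <= cnorm2 x.
Proof.
rewrite -(ler_pXn2r (n := 2)) ?nnegrE ?normc_ge0 ?sqrtr_ge0 // cnorm2_sqr.
by rewrite /csq (bigD1 i) //= lerDl sumr_ge0 // => j _; rewrite sqr_ge0.
Qed.

Lemma normc_sum (I : finType) (F : I -> C) : normc (\sum_i F i) <= \sum_i normc (F i).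
Proof.
elim/big_rec2: _ => [|i u v _ h]; first by rewrite ComplexField.Normc.normc0.
by apply: le_trans (le_normcD _ _) _; rewrite lerD2l.
Qed.

(** Every entry of a vector in the unit ball has modulus at most 1, so row sums of
moduli bound the image; without such a bound the supremum defining [opnorm2]
would carry no information. *)
Lemma opnorm2_bounded m n (B : 'M[C]_(m, n)) :
  has_ubound [set cnorm2 (B *m x) | x in [set x : 'cV[C]_n | cnorm2 x <= 1]].
Proof.
exists (Num.sqrt (\sum_i (\sum_j normc (B i j)) ^+ 2)) => _ [x /= x1 <-].
rewrite ler_wsqrtr //; apply: ler_sum => i _.
rewrite ler_pXn2r ?nnegrE ?normc_ge0 //; last by apply: sumr_ge0 => j _; rewrite normc_ge0.
rewrite mxE; apply: le_trans (normc_sum _) _; apply: ler_sum => j _.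
rewrite ComplexField.Normc.normcM ler_piMr ?normc_ge0 //.
exact: le_trans (normc_entry_le _ _) x1.
Qed.

Lemma csqZ n (a : C) (x : 'cV[C]_n) : csq (a *: x) = normc a ^+ 2 * csq x.
Proof.
rewrite mulr_sumr; apply: eq_bigr => i _.
by rewrite !mxE ComplexField.Normc.normcM exprMn.
Qed.

Lemma csq_opnorm2 m n (B : 'M[C]_(m, n)) (x : 'cV[C]_n) :
  csq (B *m x) <= opnorm2 B ^+ 2 * csq x.
Proof.
have [x0|x0] := eqVneq (csq x) 0.
  have -> : x = 0.
    apply/matrixP => i j; rewrite (ord1 j) mxE; apply: ComplexField.Normc.eq0_normc.
    move/eqP: x0; rewrite psumr_eq0; last by move=> ? _; rewrite sqr_ge0.
    by move/allP => /(_ i); rewrite mem_index_enum sqrf_eq0 => /(_ isT) /eqP.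
  rewrite mulmx0.
  have -> : csq (0 : 'cV[C]_m) = 0.
    by rewrite /csq big1 // => i _; rewrite mxE ComplexField.Normc.normc0 expr0n.
  by rewrite mulr_ge0 ?sqr_ge0 ?csq_ge0.
have xp : 0 < cnorm2 x by rewrite sqrtr_gt0 lt_def x0 csq_ge0.
pose a := real_complex R (cnorm2 x)^-1.
have na : normc a = (cnorm2 x)^-1 by rewrite normcR // invr_ge0 ltW.
have h : cnorm2 (B *m (a *: x)) <= opnorm2 B.
  apply: (ub_le_sup (opnorm2_bounded B)); exists (a *: x) => //=.
  rewrite -(ler_pXn2r (n := 2)) ?nnegrE ?sqrtr_ge0 // cnorm2_sqr csqZ na.
  by rewrite -cnorm2_sqr -exprMn mulVf ?gt_eqF.
have : cnorm2 (B *m (a *: x)) ^+ 2 <= opnorm2 B ^+ 2.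
  by rewrite ler_pXn2r ?nnegrE ?sqrtr_ge0 // (le_trans _ h) ?sqrtr_ge0.
rewrite cnorm2_sqr -scalemxAr csqZ na exprVn cnorm2_sqr.
by rewrite mulrC ler_pdivrMr // -cnorm2_sqr exprn_gt0.
Qed.

End ComplexSquaredNorm.

(** * Jordan matrices *)

Section Jordan.
Variable R : realType.
Local Notation C := (complex R).
Local Notation normc := (@ComplexField.Normc.normc R).

(** The action of the nilpotent matrix with ones on the superdiagonal; the entry
that falls off the end is replaced by 0. *)
Definition shiftv n (x : 'cV[C]_n) : 'cV[C]_n :=
  \col_i (if insub i.+1 is Some r then x r 0 else 0).

Lemma csq_shiftv n (x : 'cV[C]_n) : csq (shiftv x) <= csq x.
Proof.
case: n x => [|n] x; first by rewrite /csq !big_ord0.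
rewrite /csq big_ord_recr [X in _ <= X]big_ord_recl /= addrC.
apply: lerD.
  rewrite mxE insubF ?ltnn //.
  by rewrite ComplexField.Normc.normc0 expr0n sqr_ge0.
apply: ler_sum => i _; rewrite mxE insubT ?ltnS //= => h.
suff -> : Sub (bump 0 i) h = lift ord0 i by [].
exact: val_inj.
Qed.

Lemma jordan_block_mul (eps : R) (lam : C) n (x : 'cV[C]_n) :
  jordan_block eps lam n *m x = lam *: x + real_complex R eps *: shiftv x.
Proof.
apply/matrixP => i j; rewrite (ord1 j) !mxE (bigD1 i) //= mxE eqxx; congr (_ + _).
case: insubP => [r _ er|h].
  have ri : r != i by apply: contra_eq_neq er => ->; rewrite neq_ltn ltnSn.
  rewrite (bigD1 r) //= mxE eq_sym (negbTE ri) er eqxx big1 ?addr0 // => k.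
  case/andP => ki kr; rewrite mxE eq_sym (negbTE ki) ifN ?mul0r //.
  by apply: contra kr => /eqP e; apply/eqP/val_inj; rewrite /= er.
rewrite mulr0 big1 // => k ki; rewrite mxE eq_sym (negbTE ki) ifN ?mul0r //.
by apply: contra h => /eqP <-; apply: ltn_ord.
Qed.

Section Matrix.
Variables (B : nat) (lam : 'I_B -> C) (sz : 'I_B -> nat) (eps : R).
Local Notation n := (\sum_b sz b)%N.
Local Notation Je := (jordan_mx eps lam sz).

Definition bshift (x : 'cV[C]_n) : 'cV[C]_n := \mxcol_b shiftv (submxcol x b).

Lemma csq_bshift x : csq (bshift x) <= csq x.
Proof.
rewrite -[X in _ <= csq X]submxcolK !csq_mxcol.
by apply: ler_sum => b _; apply: csq_shiftv.
Qed.

Lemma jordan_mxE (x : 'cV[C]_n) p :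
  (Je *m x) p 0 = lam (tagnat.sig1 p) * x p 0 + real_complex R eps * bshift x p 0.
Proof.
rewrite /jordan_mx -{1}[x]submxcolK mul_mxdiag_mxcol.
rewrite mxE jordan_block_mul !mxE; congr (_ * x _ _ + _).
exact: tagnat.sig2K.
Qed.

Hypothesis sz_gt0 : forall b, (0 < sz b)%N.

(** The last row of a Jordan block has no superdiagonal entry, so the
corresponding coordinate row vector is a left eigenvector. *)
Lemma jordan_eigenvector b :
  exists2 v : 'rV[C]_n, v != 0 & v *m Je = lam b *: v.
Proof.
have hl : ((sz b).-1 < sz b)%N by rewrite prednK.
pose l := @tagnat.Rank _ sz b (Ordinal hl).
exists (delta_mx 0 l).
  by apply/eqP => /matrixP /(_ 0 l) /eqP; rewrite !mxE !eqxx /= oner_eq0.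
apply/matrixP => i j; rewrite (ord1 i) -rowE.
have -> : row l Je 0 j = (Je *m (delta_mx j 0 : 'cV[C]_n)) l 0.
  by rewrite -colE !mxE.
rewrite jordan_mxE /l tagnat.Rank1K.
suff -> : bshift (delta_mx j 0) (tagnat.Rank b (Ordinal hl)) 0 = 0.
  by rewrite !mxE mulr0 addr0 andbT eq_sym.
by rewrite !mxE insubF // tagnat.Rank2K /= tagnat.Rank1K prednK // ltnn.
Qed.
End Matrix.

(** Eigenvalues are roots of the characteristic polynomial, a finite set; this is
what makes the supremum in [spectral_radius] an upper bound. *)
Lemma spectral_bounded n (D : 'M[C]_n) :
  has_ubound [set normc a | a in [set a : C | eigenvalue D a]].
Proof.
have [s Hs] := closed_field_poly_normal (char_poly D).
exists (\sum_(z <- s) normc z) => _ [a /= Da <-].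
have : a \in s.
  move: Da; rewrite eigenvalue_root_char Hs rootZ ?root_prod_XsubC //.
  by rewrite lead_coef_eq0 monic_neq0 // char_poly_monic.
elim: s {Hs} => //= z s IH; rewrite inE big_cons => /orP[/eqP ->|h].
  by rewrite lerDl sumr_ge0 // => w _; rewrite normc_ge0.
by apply: le_trans (IH h) _; rewrite lerDr normc_ge0.
Qed.

Lemma eigenvalue_spectral_radius n (D : 'M[C]_n) (v : 'rV[C]_n) a :
  v != 0 -> v *m D = a *: v -> normc a <= spectral_radius D.
Proof.
move=> v0 h; apply: (ub_le_sup (spectral_bounded D)); exists a => //=.
by apply/eigenvalueP; exists v.
Qed.

Lemma spectral_radius_ge0 n (D : 'M[C]_n) : 0 <= spectral_radius D.
Proof.
have [[_ [a h _]]|] := pselect ([set normc a | a in [set a | eigenvalue D a]] !=set0).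
  by apply: le_trans (normc_ge0 a) _; apply: (ub_le_sup (spectral_bounded D)); exists a => /=.
by move=> /set0P/negP/negPn/eqP h; rewrite /spectral_radius h sup0.
Qed.

(** Convexity of the square, applied entry by entry with weights [s] and [t]; it
replaces the triangle inequality for the Euclidean norm. *)
Lemma csq_convex n (s t : R) (x y z : 'cV[C]_n) : 0 <= s -> 0 <= t ->
  (forall p, normc (z p 0) <= s * normc (x p 0) + t * normc (y p 0)) ->
  csq z <= (s + t) * (s * csq x + t * csq y).
Proof.
move=> s0 t0 h; rewrite /csq !mulr_sumr -big_split /= mulr_sumr.
apply: ler_sum => p _; move: (h p).
have := normc_ge0 (x p 0); have := normc_ge0 (y p 0); have := normc_ge0 (z p 0).
move: (normc _) (normc _) (normc _) => a b c c0 b0 a0 hc.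
have h1 : c ^+ 2 <= (s * a + t * b) ^+ 2.
  by rewrite ler_pXn2r ?nnegrE // addr_ge0 // mulr_ge0.
apply: le_trans h1 _; rewrite -subr_ge0.
have -> : (s + t) * (s * a ^+ 2 + t * b ^+ 2) - (s * a + t * b) ^+ 2
  = s * t * (a - b) ^+ 2 by ring.
by rewrite mulr_ge0 ?sqr_ge0 // mulr_ge0.
Qed.

Section MatrixNorm.
Variables (B : nat) (lam : 'I_B -> C) (sz : 'I_B -> nat) (eps : R).
Hypothesis sz_gt0 : forall b, (0 < sz b)%N.
Hypothesis eps_gt0 : 0 < eps.
Local Notation n := (\sum_b sz b)%N.
Local Notation Je := (jordan_mx eps lam sz).

(** A Jordan matrix is its diagonal, of norm at most the spectral radius, plus
[eps] times a shift, of norm at most 1. *)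
Lemma csq_jordan (x : 'cV[C]_n) :
  csq (Je *m x) <= (spectral_radius Je + eps) ^+ 2 * csq x.
Proof.
have r0 := spectral_radius_ge0 Je; have e0 := ltW eps_gt0.
(* Row [p] of the product combines the diagonal entry with one shifted entry. *)
have h : forall p, normc ((Je *m x) p 0) <=
    spectral_radius Je * normc (x p 0) + eps * normc (bshift x p 0).
  move=> p; rewrite jordan_mxE; apply: le_trans (le_normcD _ _) _.
  rewrite !ComplexField.Normc.normcM normcR //.
  rewrite lerD2r ler_wpM2r ?normc_ge0 //.
  have [v v0 hv] := jordan_eigenvector lam eps sz_gt0 (tagnat.sig1 p).
  exact: eigenvalue_spectral_radius v0 hv.
apply: le_trans (csq_convex r0 e0 h) _.
rewrite expr2 -mulrA ler_wpM2l ?addr_ge0 // mulrDl lerD2l ler_wpM2l //.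
exact: csq_bshift.
Qed.

Lemma csq_1Bjordan (x : 'cV[C]_n) :
  csq ((1%:M - Je) *m x) <= (spectral_radius (1%:M - Je) + eps) ^+ 2 * csq x.
Proof.
have r0 := spectral_radius_ge0 (1%:M - Je); have e0 := ltW eps_gt0.
have h : forall p, normc (((1%:M - Je) *m x) p 0) <=
    spectral_radius (1%:M - Je) * normc (x p 0) + eps * normc (bshift x p 0).
  move=> p; rewrite mulmxBl mul1mx.
  have -> : (x - Je *m x) p 0 = (1 - lam (tagnat.sig1 p)) * x p 0
      - real_complex R eps * bshift x p 0.
    by rewrite [LHS]mxE [X in _ + X]mxE jordan_mxE; ring.
  apply: le_trans (le_normcD _ _) _.
  rewrite normcN !ComplexField.Normc.normcM normcR //.
  rewrite lerD2r ler_wpM2r ?normc_ge0 //.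
  have [v v0 hv] := jordan_eigenvector lam eps sz_gt0 (tagnat.sig1 p).
  apply: (eigenvalue_spectral_radius v0).
  by rewrite mulmxBr mulmx1 hv scalerBl scale1r.
apply: le_trans (csq_convex r0 e0 h) _.
rewrite expr2 -mulrA ler_wpM2l ?addr_ge0 // mulrDl lerD2l ler_wpM2l //.
exact: csq_bshift.
Qed.
End MatrixNorm.
End Jordan.

(** * The mixing matrix in Jordan coordinates *)

Section MixingEstimates.
Variable R : realType.
Local Notation C := (complex R).
Local Notation normc := (@ComplexField.Normc.normc R).

Lemma mxCM m n p (S : 'M[R]_(m, n)) (T : 'M[R]_(n, p)) :
  mxC (S *m T) = mxC S *m mxC T.
Proof. exact: (map_mxM (real_complex R)). Qed.

Lemma mxCD m n (S T : 'M[R]_(m, n)) : mxC (S + T) = mxC S + mxC T.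
Proof. exact: (map_mxD (real_complex R)). Qed.

Lemma mxCB m n (S T : 'M[R]_(m, n)) : mxC (S - T) = mxC S - mxC T.
Proof. exact: (map_mxB (real_complex R)). Qed.

Lemma mxCZ m n a (S : 'M[R]_(m, n)) : mxC (a *: S) = real_complex R a *: mxC S.
Proof. exact: (map_mxZ (real_complex R)). Qed.

Definition mixing (n : nat) (gamma : R) (A : 'M[R]_n) : 'M[R]_n :=
  (1 - gamma) *: 1%:M + gamma *: A.

Variables (N P : nat) (M : 'I_N -> nat).
Local Notation n := (\sum_k M k)%N.
Variables (U : 'M[R]_(n, P)) (A : 'M[R]_n).
Variables (B : nat) (lam : 'I_B -> C) (sz : 'I_B -> nat).
Variables (VR VL : 'M[C]_(n, \sum_b sz b)) (eps : R).
Hypothesis jordan : jordan_decomposition U lam VR VL eps A.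
Local Notation Je := (jordan_mx eps lam sz).

Lemma VL_biorthogonal : VL^T *m mxC U = 0 /\ VL^T *m VR = 1%:M.
Proof.
have := jd_VinvV jordan; rewrite /Vinv_eps /V_eps mul_col_row.
by rewrite scalar_mx_block => /eq_block_mx [_ _ -> ->].
Qed.

(** Resolution of the identity: removing the component in the range of [U] leaves
the part carried by [VR]. *)
Lemma complement_split (x : 'cV[R]_n) :
  mxC (x - U *m (U^T *m x)) = VR *m (VL^T *m mxC x).
Proof.
have := jd_VVinv jordan; rewrite /Vinv_eps /V_eps mul_row_col => h.
rewrite mxCB !mxCM mulmxA -[X in X - _]mul1mx -mulmxBl -h.
by rewrite [X in X - _]addrC addrK mulmxA.
Qed.

Lemma A_complement (x : 'cV[R]_n) : VL^T *m mxC (A *m x) = Je *m (VL^T *m mxC x).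
Proof.
have [h0 h1] := VL_biorthogonal.
rewrite mxCM (jd_A jordan) /Vinv_eps /V_eps mul_row_block !mulmx0 add0r addr0.
rewrite mulmx1 mul_row_col mulmxDl mulmxDr !mulmxA h0 !mul0mx add0r.
by rewrite h1 mul1mx.
Qed.

(** [I - A] kills the range of [U], hence sees only the complementary coordinates. *)
Lemma IA_complement (x : 'cV[R]_n) :
  mxC (x - A *m x) = VR *m ((1%:M - Je) *m (VL^T *m mxC x)).
Proof.
have := jd_VVinv jordan; rewrite /Vinv_eps /V_eps mul_row_col => h.
rewrite mxCB mxCM (jd_A jordan) /Vinv_eps /V_eps mul_row_block !mulmx0 add0r addr0.
rewrite mulmx1 mul_row_col -[X in X - _]mul1mx -h -mulmxBl opprD addrACA subrr add0r.
by rewrite !mulmxA mulmxBr mulmx1 !mulmxBl.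
Qed.

Lemma mxC_mixing gamma (x : 'cV[R]_n) :
  mxC (mixing gamma A *m x) =
  real_complex R (1 - gamma) *: mxC x + real_complex R gamma *: mxC (A *m x).
Proof. by rewrite mulmxDl -!scalemxAl mul1mx mxCD !mxCZ. Qed.

(** The spectral quantities enter only through the norm bounds they provide, so
they are abstracted here into [rho], [kap], [v1] and [v2].  Multiplying the
condition on [gamma] by [gamma] turns it into [4 * v * bq * q < dl], where [dl] is
the contraction gained by one mixing step and [q] bounds the squared norm of
[I - W] relative to the disagreement. *)
Lemma mixing_estimates_of_norms (gamma bq rho kap v1 v2 : R) :
  0 < rho < 1 -> 0 <= bq -> 0 < gamma < 1 ->
  gamma < (1 - rho) / (4 * v1 ^+ 2 * v2 ^+ 2 * bq * kap ^+ 2) ->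
  (forall y, csq (VR *m y) <= v2 ^+ 2 * csq y) ->
  (forall x : 'cV[R]_n,
     sqn (U^T *m x) + csq (VL^T *m mxC x) <= v1 ^+ 2 * sqn x) ->
  (forall y, csq (Je *m y) <= rho ^+ 2 * csq y) ->
  (forall y, csq ((1%:M - Je) *m y) <= kap ^+ 2 * csq y) ->
  exists m (K : 'M[R]_(m, n)) (v q r dl : R),
  [/\ 0 < dl <= 1, [/\ 0 <= v, 0 <= q & 0 <= r] & 4 * v * bq * q < dl] /\
  [/\ forall x, sqn (K *m (mixing gamma A *m x)) <= (1 - dl) * sqn (K *m x),
      forall x, sqn (K *m x) <= v * sqn x,
      forall x, sqn (U^T *m x) <= v * sqn x,
      forall x, sqn (x - mixing gamma A *m x) <= q * sqn (K *m x) &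
      forall x, sqn (x - U *m (U^T *m x)) <= r * sqn (K *m x)].
Proof.
move=> /andP[rh0 rh1] bq0 /andP[g0 g1] gb VRle Vle hJ hI.
have den0 : 0 < 4 * v1 ^+ 2 * v2 ^+ 2 * bq * kap ^+ 2.
  rewrite lt_def; apply/andP; split; last first.
    by rewrite mulr_ge0 ?sqr_ge0 // mulr_ge0 // mulr_ge0 ?sqr_ge0 // mulr_ge0 ?sqr_ge0.
  by apply: contraL gb => /eqP ->; rewrite invr0 mulr0 -leNgt ltW.
have gb' : gamma * (4 * v1 ^+ 2 * v2 ^+ 2 * bq * kap ^+ 2) < 1 - rho.
  by rewrite -ltr_pdivlMr.
exists _, (realify VL^T), (v1 ^+ 2), (gamma ^+ 2 * (v2 ^+ 2 * kap ^+ 2)), (v2 ^+ 2).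
exists (gamma * (1 - rho)); split; split.
- have h : 0 < 1 - rho by rewrite subr_gt0.
  by rewrite mulr_gt0 //= mulr_ile1 ?(ltW g0, ltW g1, ltW h) // gerBl ltW.
- by split; rewrite ?sqr_ge0 // mulr_ge0 ?sqr_ge0 // mulr_ge0 ?sqr_ge0.
- rewrite -(ltr_pM2l g0) in gb'; apply: le_lt_trans gb'.
  by rewrite le_eqVlt; apply/orP; left; apply/eqP; ring.
- move=> x; rewrite !sqn_realify mxC_mixing mulmxDr -!scalemxAr A_complement.
  set y := VL^T *m _.
  have g1' : 0 <= 1 - gamma by rewrite subr_ge0 ltW.
  have h p : normc ((real_complex R (1 - gamma) *: y + real_complex R gamma *: (Je *m y)) p 0)
     <= (1 - gamma) * normc (y p 0) + gamma * normc ((Je *m y) p 0).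
    rewrite mxE [X in X + _]mxE [X in _ + X]mxE.
    apply: le_trans (le_normcD _ _) _.
    by rewrite !ComplexField.Normc.normcM !normcR // ltW.
  apply: le_trans (csq_convex g1' (ltW g0) h) _.
  rewrite subrK mul1r.
  have hJy := hJ y.
  have hJ' : csq (Je *m y) <= rho * csq y.
    by apply: le_trans hJy _; rewrite ler_wpM2r ?csq_ge0 // expr2 ler_piMr // ltW.
  have -> : 1 - gamma * (1 - rho) = (1 - gamma) + gamma * rho by ring.
  by rewrite [X in _ <= X]mulrDl lerD2l -mulrA ler_wpM2l // ltW.
- by move=> x; rewrite sqn_realify; apply: le_trans (Vle x); rewrite lerDr sqn_ge0.
- by move=> x; apply: le_trans (Vle x); rewrite lerDl csq_ge0.
- move=> x; rewrite sqn_realify.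
  have -> : x - mixing gamma A *m x = gamma *: (x - A *m x).
    rewrite mulmxDl -!scalemxAl mul1mx; set y := A *m x.
    by apply/matrixP => i j; rewrite !mxE; ring.
  rewrite sqnZ -mulrA ler_wpM2l ?sqr_ge0 // -csq_real IA_complement.
  apply: le_trans (VRle _) _; rewrite -mulrA ler_wpM2l ?sqr_ge0 //.
- by move=> x; rewrite sqn_realify -csq_real complement_split.
Qed.

(** All that the dynamics needs from the combination matrix: in the coordinates
[K] of the disagreement, mixing contracts by [1 - dl], while the quantizer input
caused by disagreement has squared norm at most [q] times that of the disagreement, with
[q] small enough for the quantization noise, of relative size [bq], to use up at most half
of that contraction. *)
Lemma mixing_estimates (gamma bq : R) : 0 <= bq ->
  0 < gamma < gamma_bound U lam VR VL eps bq ->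
  exists m (K : 'M[R]_(m, n)) (v q r dl : R),
  [/\ 0 < dl <= 1, [/\ 0 <= v, 0 <= q & 0 <= r] & 4 * v * bq * q < dl] /\
  [/\ forall x, sqn (K *m (mixing gamma A *m x)) <= (1 - dl) * sqn (K *m x),
      forall x, sqn (K *m x) <= v * sqn x,
      forall x, sqn (U^T *m x) <= v * sqn x,
      forall x, sqn (x - mixing gamma A *m x) <= q * sqn (K *m x) &
      forall x, sqn (x - U *m (U^T *m x)) <= r * sqn (K *m x)].
Proof.
move=> bq0 /andP[g0].
have [eps0 sz0 _ rh _ _ _] := jordan.
rewrite /gamma_bound lt_min => /andP[g1 gb].
have VRle y : csq (VR *m y) <= opnorm2 (V_eps U VR) ^+ 2 * csq y.
  have := csq_opnorm2 (V_eps U VR) (col_mx 0 y).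
  rewrite /V_eps mul_row_col mulmx0 add0r csq_col_mx.
  suff -> : csq (0 : 'cV[C]_P) = 0 by rewrite add0r.
  by rewrite /csq big1 // => i _; rewrite mxE ComplexField.Normc.normc0 expr0n.
have Vle (x : 'cV[R]_n) : sqn (U^T *m x) + csq (VL^T *m mxC x) <= opnorm2 (Vinv_eps U VL) ^+ 2 * sqn x.
  have := csq_opnorm2 (Vinv_eps U VL) (mxC x).
  by rewrite /Vinv_eps mul_col_mx csq_col_mx -!csq_real mxCM.
apply: (mixing_estimates_of_norms rh bq0 _ gb VRle Vle).
- by rewrite g0.
- exact: csq_jordan.
- exact: csq_1Bjordan.
Qed.
End MixingEstimates.

(** * Gradients and Hessians of the costs *)

Section GradientEstimates.
Variable R : realType.

Lemma is_derive_line n (f : 'cV[R]_n -> R) (a u : 'cV[R]_n) (t df : R) :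
  is_derive (a + t *: u) u f df -> is_derive t 1 (fun s : R => f (a + s *: u)) df.
Proof.
have e : (fun h : R => h^-1 *: (((fun s : R => f (a + s *: u)) \o shift t) (h *: 1)
             - f (a + t *: u)))
  = (fun h : R => h^-1 *: ((f \o shift (a + t *: u)) (h *: u) - f (a + t *: u))).
  apply/funext => h /=; congr (_ *: (f _ - _)).
  by rewrite [h *: 1]mulr1 scalerDl addrCA.
by move=> [d v]; split; [rewrite /derivable e|rewrite /derive e].
Qed.

(** The derivative of the gradient along a line is the Hessian applied to the
direction; pairing with a fixed [v] makes the function scalar, which is what the
mean value theorem requires. *)
Lemma is_derive_grad_line n (f : 'cV[R]_n -> R) (v a u : 'cV[R]_n) (t : R) :
  (forall x, differentiable (grad f) x) ->
  is_derive t 1 (fun s : R => dotv v (grad f (a + s *: u)))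
    (dotv v (hess f (a + t *: u) *m u)).
Proof.
move=> dg; set b := a + t *: u.
have db (w : 'cV[R]_n) : derivable (grad f) b w by apply: diff_derivable; apply: dg.
have Db i : 'D_u (fun x => grad f x i 0) b = (hess f b *m u) i 0.
  have -> : 'D_u (fun x => grad f x i 0) b = ('D_u (grad f) b) i 0.
    by rewrite derive_mx // mxE.
  rewrite deriveE //.
  have -> : u = \sum_j u j 0 *: delta_mx j 0.
    rewrite {1}[u]matrix_sum_delta; apply: eq_bigr => j _.
    by rewrite big_ord1.
  rewrite linear_sum summxE mulmx_sumr summxE; apply: eq_bigr => j _.
  by rewrite linearZ -scalemxAr -colE !mxE deriveE.
have h i : is_derive t 1 (fun s : R => v i 0 * grad f (a + s *: u) i 0)
    (v i 0 * (hess f b *m u) i 0).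
  apply: is_deriveZ.
  apply: (is_derive_line (f := fun x => grad f x i 0)).
  rewrite -/b -Db; apply: derivableP.
  by have /derivable_mxP := db u; apply.
have := @is_derive_sum R R R n
  (fun i => fun s : R => v i 0 * grad f (a + s *: u) i 0) t 1 _ h.
by congr is_derive; apply/funext => s; rewrite fct_sumE.
Qed.

Variables (N : nat) (M : 'I_N -> nat).
Variable J : forall k : 'I_N, 'cV[R]_(M k) -> R.
Hypothesis dg : forall k x, differentiable (grad (@J k)) x.

(** The mean value theorem for the sum over all agents at once: a single
intermediate point serves all of them, so that the bound on the aggregate Hessian
applies to the right-hand side. *)
Lemma gradient_mean_value (a u v : forall k, 'cV[R]_(M k)) :
  exists c : R,
    \sum_k dotv (v k) (grad (@J k) (a k + u k) - grad (@J k) (a k))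
    = \sum_k dotv (v k) (hess (@J k) (a k + c *: u k) *m u k).
Proof.
pose f (t : R) := \sum_k dotv (v k) (grad (@J k) (a k + t *: u k)).
pose df (t : R) := \sum_k dotv (v k) (hess (@J k) (a k + t *: u k) *m u k).
have fdf (t : R) : is_derive t 1 f (df t).
  have := @is_derive_sum R R R N
    (fun k => fun s : R => dotv (v k) (grad (@J k) (a k + s *: u k))) t 1 _
    (fun k => is_derive_grad_line (v k) (a k) (u k) t (@dg k)).
  by congr is_derive; apply/funext => s; rewrite fct_sumE.
have cf : {within `[0, 1], continuous f}.
  apply: derivable_within_continuous => t _; exact: ex_derive.
have [c _] := MVT ltr01 (fun t _ => fdf t) cf.
rewrite subr0 mulr1 => e; exists c; rewrite -[RHS]e /f -sumrB.
apply: eq_bigr => k _; rewrite scale1r scale0r addr0 /dotv -sumrB.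
by apply: eq_bigr => i _; rewrite !mxE mulrBr.
Qed.

End GradientEstimates.

Section Loewner.
Variable R : realType.

Lemma psd_dotv n (H : 'M[R]_n) (x : 'cV[R]_n) : psd H -> 0 <= dotv x (H *m x).
Proof. by move=> [_ /(_ x)]; rewrite dotv_mx mulmxA. Qed.

Lemma loewner_scalar_ge n (H : 'M[R]_n) c (x : 'cV[R]_n) :
  loewner_le c%:M H -> c * sqn x <= dotv x (H *m x).
Proof.
move/psd_dotv => /(_ x); rewrite mulmxBl dotvBr mul_scalar_mx dotvZr dotvv.
by rewrite subr_ge0.
Qed.

Lemma loewner_scalar_le n (H : 'M[R]_n) c (x : 'cV[R]_n) :
  loewner_le H c%:M -> dotv x (H *m x) <= c * sqn x.
Proof.
move/psd_dotv => /(_ x); rewrite mulmxBl dotvBr mul_scalar_mx dotvZr dotvv.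
by rewrite subr_ge0.
Qed.

Lemma loewner_sym n (H : 'M[R]_n) c : loewner_le c%:M H -> H^T = H.
Proof.
move=> [h _]; move: h; rewrite linearB /= tr_scalar_mx => /eqP.
by rewrite (inj_eq (addIr _)) => /eqP.
Qed.

(** Positivity of [H] on [v - L *: u] bounds the bilinear form by the two quadratic
forms, hence by [L]: a Cauchy-Schwarz inequality without square roots. *)
Lemma loewner_bilinear_le n (H : 'M[R]_n) c L (v u : 'cV[R]_n) :
  0 <= c -> 0 < L -> loewner_le c%:M H -> loewner_le H L%:M ->
  dotv v (H *m u) *+ 2 <= sqn v + L ^+ 2 * sqn u.
Proof.
move=> c0 L0 Hc HL; pose w := v - L *: u.
have w0 : 0 <= dotv w (H *m w).
  by apply: le_trans (loewner_scalar_ge w Hc); rewrite mulr_ge0 ?sqn_ge0.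
have sH : dotv u (H *m v) = dotv v (H *m u).
  by rewrite dotvC dotv_mulmxl (loewner_sym Hc).
have e : dotv w (H *m w) = dotv v (H *m v) - L * dotv v (H *m u) *+ 2
    + L ^+ 2 * dotv u (H *m u).
  by rewrite /w mulmxBr -scalemxAr !(dotvBr, dotvBl, dotvZr, dotvZl) sH; ring.
have hv := loewner_scalar_le v HL; have hu := loewner_scalar_le u HL.
have {}hu : L ^+ 2 * dotv u (H *m u) <= L ^+ 2 * (L * sqn u).
  by rewrite ler_wpM2l ?sqr_ge0.
rewrite -(ler_pM2l L0).
by move: w0; rewrite e; lra.
Qed.

End Loewner.

Section CostEstimates.
Variable R : realType.
Variables (N P : nat) (M : 'I_N -> nat).
Variable J : forall k : 'I_N, 'cV[R]_(M k) -> R.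
Variable U : 'M[R]_(\sum_k M k, P).
Local Notation n := (\sum_k M k)%N.

Definition grad_stack (w : 'cV[R]_n) : 'cV[R]_n :=
  \mxcol_k grad (@J k) (submxcol w k).

Variables (lk_min lk_max : 'I_N -> R) (l_min l_max : R).
Hypothesis costs : cost_assumption J U lk_min lk_max l_min l_max.

Lemma grad_differentiable k x : differentiable (grad (@J k)) x.
Proof. by have [_ h] := cost_twice_diff costs k; apply: h. Qed.

(** Pair the gradient difference with itself in the mean value identity; the
right-hand side of the bilinear bound is then half absorbed by the left-hand side. *)
Lemma grad_stack_lipschitz :
  exists2 L : R, 0 < L &
    forall x y, sqn (grad_stack x - grad_stack y) <= L ^+ 2 * sqn (x - y).
Proof.
(* Adding 1 makes [L] positive even when all the upper curvatures vanish. *)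
pose L := 1 + \sum_k `|lk_max k|; exists L.
  by apply: ltr_pwDl => //; apply: sumr_ge0.
move=> x y; pose a k := submxcol y k; pose u k := submxcol (x - y) k.
pose v k := grad (@J k) (a k + u k) - grad (@J k) (a k).
have -> : grad_stack x - grad_stack y = \mxcol_k v k.
  rewrite /grad_stack -mxcolB; apply/eq_mxcol => k.
  by rewrite /v /a /u submxcolB [submxcol y k + _]addrC subrK.
have L0 : 0 < L by apply: ltr_pwDl => //; apply: sumr_ge0.
have [c] := gradient_mean_value grad_differentiable a u v.
have -> : \sum_k dotv (v k) (grad (@J k) (a k + u k) - grad (@J k) (a k)) =
    \sum_k sqn (v k) by apply: eq_bigr => k _; rewrite dotvv.
have -> : sqn (x - y) = \sum_k sqn (u k) by rewrite -sqn_mxcol submxcolK.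
rewrite sqn_mxcol => e.
have : (\sum_k sqn (v k)) *+ 2 <= \sum_k (sqn (v k) + L ^+ 2 * sqn (u k)).
  rewrite {1}e -sumrMnl; apply: ler_sum => k _.
  have [h1 h2] := cost_local_hess costs (a k + c *: u k).
  apply: (loewner_bilinear_le _ _ (cost_local_ge0 costs k) L0 h1).
  split.
    by rewrite linearB /= tr_scalar_mx (loewner_sym h1).
  move=> w; rewrite -mulmxA -dotv_mx mulmxBl dotvBr mul_scalar_mx dotvZr dotvv subr_ge0.
  apply: le_trans (loewner_scalar_le w h2) _; rewrite ler_wpM2r ?sqn_ge0 //.
  apply: le_trans (ler_norm _) _; rewrite /L (bigD1 k) //= addrCA lerDl addr_ge0 //.
  exact: sumr_ge0.
by rewrite big_split /= mulr2n lerD2l mulr_sumr.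
Qed.

(** Strong monotonicity holds only along the range of [U], where the aggregate
Hessian is bounded below; single costs may be flat. *)
Lemma grad_stack_monotone x y :
  l_min * sqn y <= dotv (U *m y) (grad_stack (x + U *m y) - grad_stack x).
Proof.
pose a k := submxcol x k; pose u k := submxcol (U *m y) k.
have [c e] := gradient_mean_value grad_differentiable a u u.
have -> : grad_stack (x + U *m y) - grad_stack x =
    \mxcol_k (grad (@J k) (a k + u k) - grad (@J k) (a k)).
  by rewrite /grad_stack -mxcolB; apply/eq_mxcol => k; rewrite submxcolD.
have -> : U *m y = \mxcol_k u k by rewrite submxcolK.
rewrite dotv_mxcol e -dotv_mxcol -mul_mxdiag_mxcol.
rewrite submxcolK dotv_mulmxl !mulmxA.
have [h _] := cost_global_hess costs (fun k => a k + c *: u k).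
exact: loewner_scalar_ge.
Qed.

End CostEstimates.

Section DriftEstimates.
Variable R : realType.
Variables (N P : nat) (M : 'I_N -> nat).
Variable J : forall k : 'I_N, 'cV[R]_(M k) -> R.
Variable U : 'M[R]_(\sum_k M k, P).
Local Notation n := (\sum_k M k)%N.
Local Notation G := (grad_stack J).
Variables (lk_min lk_max : 'I_N -> R) (l_min l_max : R).
Hypothesis costs : cost_assumption J U lk_min lk_max l_min l_max.
Hypothesis orthU : U^T *m U = 1%:M.

Lemma sqn_isometry (y : 'cV[R]_P) : sqn (U *m y) = sqn y.
Proof. by rewrite -!dotvv dotv_mulmxl mulmxA orthU mul1mx. Qed.

Variables (W : 'M[R]_n) (wo : 'cV[R]_n) (m : nat) (K : 'M[R]_(m, n)) (q r : R).
Hypotheses (q0 : 0 <= q) (r0 : 0 <= r).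
Hypothesis hq : forall x, sqn (x - W *m x) <= q * sqn (K *m x).
Hypothesis hr : forall x, sqn (x - U *m (U^T *m x)) <= r * sqn (K *m x).

(** Let [y := U^T *m x].  Then [W *m x] differs from [U *m y] by a vector of the order
of the disagreement.  The gradient at [wo - U *m y] is strongly monotone in [y], and
Lipschitz continuity transfers this to [wo - W *m x] at the cost of a constant
multiple of the squared disagreement; the constant 1 in the bounds comes from the
gradient at [wo]. *)
Lemma drift_estimates : exists2 C : R, 0 <= C & forall x : 'cV[R]_n,
  [/\ sqn (W *m x) <= C * (sqn (U^T *m x) + sqn (K *m x)),
      sqn (G (wo - W *m x)) <= C * (1 + sqn (U^T *m x) + sqn (K *m x)) &
      dotv (U^T *m x) (U^T *m G (wo - W *m x)) *+ 2
        <= - l_min * sqn (U^T *m x) + C * (1 + sqn (K *m x))].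
Proof.
have [L L0 HL] := grad_stack_lipschitz costs.
have l0 : 0 < l_min by case/andP: (cost_global_gt0 costs).
have [C1 C1E] : {C1 : R | C1 = 2 + 4 * (r + q)} by eexists.
pose C2 := 2 * sqn (G wo) + 2 * L ^+ 2 * C1.
pose C3 := l_min^-1 * (2 * sqn (G wo) + 2 * L ^+ 2 * C1).
have C10 : 0 <= C1 by have := q0; have := r0; rewrite C1E; lra.
have L20 := sqr_ge0 L; have G0 := sqn_ge0 (G wo).
have LC : 0 <= L ^+ 2 * C1 by rewrite mulr_ge0.
have C20 : 0 <= C2 by rewrite /C2 -mulrA addr_ge0 // mulr_ge0.
have C30 : 0 <= C3 by rewrite mulr_ge0 // invr_ge0 ltW.
exists (C1 + C2 + C3); first by lra.
move=> x; set y := U^T *m x; set a := sqn y; set b := sqn (K *m x).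
have a0 : 0 <= a := sqn_ge0 _; have b0 : 0 <= b := sqn_ge0 _.
pose e := W *m x - U *m y.
have he0 : e = (x - U *m y) - (x - W *m x).
  by rewrite opprB [RHS]addrC addrA subrK.
have he : sqn e <= C1 * b.
  rewrite he0; apply: le_trans (sqnB_le _ _) _.
  have := sqn_ge0 (x - U *m y); have := sqn_ge0 (x - W *m x).
  by have := hq x; have := hr x; rewrite -/y -/b C1E; lra.
have hW : sqn (W *m x) <= C1 * (a + b).
  have -> : W *m x = U *m y + ((x - U *m y) - (x - W *m x)).
    by rewrite -he0 /e addrC subrK.
  apply: le_trans (sqnD_le _ _) _; rewrite sqn_isometry -/a.
  have h1 := sqnB_le (x - U *m y) (x - W *m x).
  have := hq x; have := hr x; rewrite -/y -/b => h2 h3.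
  have ra : 0 <= r * a by rewrite mulr_ge0.
  have qa : 0 <= q * a by rewrite mulr_ge0.
  by rewrite C1E; lra.
have hG w w' : sqn (G w) <= 2 * sqn (G w') + 2 * (L ^+ 2 * sqn (w - w')).
  rewrite -[G w](subrK (G w')) addrC; apply: le_trans (sqnD_le _ _) _.
  by have := HL w w'; lra.
split.
- apply: le_trans hW _; rewrite ler_wpM2r; lra.
- apply: le_trans (hG _ wo) _; rewrite [wo - _ - wo]addrC addKr sqnN.
  have h1 : L ^+ 2 * sqn (W *m x) <= L ^+ 2 * (C1 * (a + b)) by rewrite ler_wpM2l.
  have h2 : 0 <= (C1 + C3) * (1 + a + b) by rewrite mulr_ge0 //; lra.
  have h3 : 0 <= sqn (G wo) * (a + b) by rewrite mulr_ge0 //; lra.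
  have h4 : C2 * (1 + a + b) = 2 * sqn (G wo) + 2 * (sqn (G wo) * (a + b))
    + 2 * (L ^+ 2 * C1) + 2 * (L ^+ 2 * (C1 * (a + b))) by rewrite /C2; ring.
  have -> : (C1 + C2 + C3) * (1 + a + b) =
    (C1 + C3) * (1 + a + b) + C2 * (1 + a + b) by ring.
  by rewrite h4; lra.
- set w := wo - W *m x; rewrite -dotv_mulmxl.
  pose h := G w - G (wo - U *m y) + G wo.
  have hm := grad_stack_monotone costs (wo - U *m y) y; rewrite subrK in hm.
  have hy := dotv_young (U *m y) h l0; rewrite sqn_isometry -/a in hy.
  have eh : dotv (U *m y) (G w) =
      dotv (U *m y) h - dotv (U *m y) (G wo - G (wo - U *m y)).
    by rewrite -dotvBr; congr dotv; rewrite /h;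
       move: (G w) (G _) (G wo) => p p' o; apply/matrixP => i j; rewrite !mxE; ring.
  have hh : sqn h <= 2 * (L ^+ 2 * (C1 * b)) + 2 * sqn (G wo).
    apply: le_trans (sqnD_le _ _) _; rewrite lerD2r.
    have h1 : L ^+ 2 * sqn e <= L ^+ 2 * (C1 * b) by rewrite ler_wpM2l.
    have := HL w (wo - U *m y).
    have -> : w - (wo - U *m y) = - e.
      rewrite /w /e; move: (W *m x) (U *m y) => p p'.
      by apply/matrixP => i j; rewrite !mxE; ring.
    by rewrite sqnN; lra.
  have h1 : l_min^-1 * sqn h <=
      l_min^-1 * (2 * (L ^+ 2 * (C1 * b)) + 2 * sqn (G wo)).
    by rewrite ler_wpM2l // invr_ge0 ltW.
  have h2 : l_min^-1 * (2 * (L ^+ 2 * (C1 * b)) + 2 * sqn (G wo))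
     <= C3 * (1 + b).
    rewrite /C3 -[X in _ <= X]mulrA ler_wpM2l ?invr_ge0 ?(ltW l0) //.
    have h3 : 0 <= sqn (G wo) * b by rewrite mulr_ge0.
    by lra.
  have h3 : 0 <= (C1 + C2) * (1 + b) by rewrite mulr_ge0 //; lra.
  by move: hm; rewrite -/a eh; lra.
Qed.
End DriftEstimates.

(** * Square-integrable random vectors *)

Section Expectation.
Context {R : realType} {d : measure_display} {T : measurableType d}.
Variable Pr : probability T R.
Implicit Types f g : T -> R.

Definition intg f := Pr.-integrable setT (fun t => (f t)%:E).
Definition Ex f : R := \int[Pr]_t f t.
Definition L2 f := measurable_fun setT f /\ intg (fun t => f t ^+ 2).

Lemma intg_meas f : intg f -> measurable_fun setT f.
Proof. by move=> h; apply/measurable_EFinP; apply: measurable_int h. Qed.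

Lemma intgD f g : intg f -> intg g -> intg (fun t => f t + g t).
Proof. by move=> hf hg; apply: (integrableD measurableT hf hg). Qed.

Lemma intgZ (c : R) f : intg f -> intg (fun t => c * f t).
Proof. by move=> hf; apply: (integrableZl measurableT c hf). Qed.

Lemma intg_cst (c : R) : intg (fun=> c).
Proof. exact: (finite_measure_integrable_cst Pr c measurableT). Qed.

Lemma intg_sum n (F : 'I_n -> T -> R) : (forall i, intg (F i)) ->
  intg (fun t => \sum_i F i t).
Proof.
move=> h; have := @integrable_sum _ _ _ Pr setT measurableT _ (index_enum 'I_n) xpredT _
  (fun i (_ : true) => h i).
by congr (_.-integrable _ _); apply/funext => t; rewrite sumEFin.
Qed.

Lemma intg_le f g : measurable_fun setT f -> (forall t, `|f t| <= g t) ->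
  intg g -> intg f.
Proof.
move=> mf fg ig; apply: (le_integrable measurableT) ig; first exact/measurable_EFinP.
by move=> t _ /=; rewrite lee_fin (le_trans (fg t)) // ler_norm.
Qed.

Lemma ExD f g : intg f -> intg g -> Ex (fun t => f t + g t) = Ex f + Ex g.
Proof. by move=> hf hg; apply: RintegralD. Qed.

Lemma ExZ (c : R) f : intg f -> Ex (fun t => c * f t) = c * Ex f.
Proof. by move=> hf; apply: RintegralZl. Qed.

Lemma Ex_cst (c : R) : Ex (fun=> c) = c.
Proof. by rewrite /Ex Rintegral_cst // [X in fine X]probability_setT mulr1. Qed.

Lemma Ex_sum n (F : 'I_n -> T -> R) : (forall i, intg (F i)) ->
  Ex (fun t => \sum_i F i t) = \sum_i Ex (F i).
Proof.
elim: n F => [|n IH] F h.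
  by rewrite big_ord0 -[RHS](Ex_cst 0); congr Ex; apply/funext => t; rewrite big_ord0.
rewrite big_ord_recl -IH // -ExD //; last exact: intg_sum.
by congr Ex; apply/funext => t; rewrite big_ord_recl.
Qed.

Lemma Ex_le f g : intg f -> intg g -> (forall t, f t <= g t) -> Ex f <= Ex g.
Proof. by move=> hf hg h; apply: le_Rintegral. Qed.

Lemma Ex_ge0 f : (forall t, 0 <= f t) -> 0 <= Ex f.
Proof. by move=> h; apply: Rintegral_ge0. Qed.

Lemma EFin_Ex f : intg f -> (\int[Pr]_t (f t)%:E = (Ex f)%:E)%E.
Proof. by move=> h; rewrite fineK //; apply: integrable_fin_num. Qed.

Lemma L2_mul f g : L2 f -> L2 g -> intg (fun t => f t * g t).
Proof.
move=> [mf f2] [mg g2]; apply: (intg_le _ _ (intgD f2 g2)).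
  exact: measurable_funM.
move=> t; rewrite normrM -(real_normK (num_real (f t))) -(real_normK (num_real (g t))).
by move: (normr_ge0 (f t)) (normr_ge0 (g t)); nra.
Qed.

Lemma L2D f g : L2 f -> L2 g -> L2 (fun t => f t + g t).
Proof.
move=> hf hg; split; first exact: measurable_funD hf.1 hg.1.
have := intgD (intgD hf.2 hg.2) (intgZ 2 (L2_mul hf hg)).
by congr intg; apply/funext => t; ring.
Qed.

Lemma L2Z (c : R) f : L2 f -> L2 (fun t => c * f t).
Proof.
move=> hf; split; first exact: measurable_funM (measurable_cst c) hf.1.
have := intgZ (c ^+ 2) hf.2.
by congr intg; apply/funext => t; rewrite exprMn.
Qed.

Lemma L2_cst (c : R) : L2 (fun=> c).
Proof. by split; [exact: measurable_cst|exact: intg_cst]. Qed.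

Lemma L2_sum n (F : 'I_n -> T -> R) : (forall i, L2 (F i)) ->
  L2 (fun t => \sum_i F i t).
Proof.
elim: n F => [|n IH] F h.
  rewrite (_ : (fun _ => _) = (fun=> 0)); first exact: L2_cst.
  by apply/funext => t; rewrite big_ord0.
rewrite (_ : (fun _ => _) = (fun t => F ord0 t + \sum_(i < n) F (lift ord0 i) t)).
  by apply: L2D => //; apply: IH.
by apply/funext => t; rewrite big_ord_recl.
Qed.

Lemma L2_intg f : L2 f -> intg f.
Proof.
move=> hf; have := L2_mul (L2_cst 1) hf.
by congr intg; apply/funext => t; rewrite mul1r.
Qed.

Definition vL2 n (X : T -> 'cV[R]_n) := forall j, L2 (fun t => X t j 0).

Lemma vL2D n (X Y : T -> 'cV[R]_n) : vL2 X -> vL2 Y -> vL2 (fun t => X t + Y t).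
Proof.
move=> hX hY j; have := L2D (hX j) (hY j).
by congr L2; apply/funext => t; rewrite mxE.
Qed.

Lemma vL2Z n (c : R) (X : T -> 'cV[R]_n) : vL2 X -> vL2 (fun t => c *: X t).
Proof.
move=> hX j; have := L2Z c (hX j).
by congr L2; apply/funext => t; rewrite mxE.
Qed.

Lemma vL2B n (X Y : T -> 'cV[R]_n) : vL2 X -> vL2 Y -> vL2 (fun t => X t - Y t).
Proof.
move=> hX hY; have := vL2D hX (vL2Z (-1) hY).
by congr vL2; apply/funext => t; rewrite scaleN1r.
Qed.

Lemma vL2_cst n (x : 'cV[R]_n) : vL2 (fun=> x).
Proof. by move=> j; apply: L2_cst. Qed.

Lemma vL2_mulmx m n (B : 'M[R]_(m, n)) (X : T -> 'cV[R]_n) :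
  vL2 X -> vL2 (fun t => B *m X t).
Proof.
move=> hX i; have := L2_sum (fun j => L2Z (B i j) (hX j)).
by congr L2; apply/funext => t; rewrite mxE.
Qed.

Lemma vL2_mxcol p (s : 'I_p -> nat) (X : forall k, T -> 'cV[R]_(s k)) :
  (forall k, vL2 (X k)) -> vL2 (fun t => \mxcol_k X k t).
Proof.
move=> h j; have := h (tagnat.sig1 j) (tagnat.sig2 j).
by congr L2; apply/funext => t; rewrite mxE.
Qed.

Lemma intg_sqn n (X : T -> 'cV[R]_n) : vL2 X -> intg (fun t => sqn (X t)).
Proof. by move=> h; apply: intg_sum => j; have [] := h j. Qed.

Lemma intg_dotv n (X Y : T -> 'cV[R]_n) : vL2 X -> vL2 Y ->
  intg (fun t => dotv (X t) (Y t)).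
Proof. by move=> hX hY; apply: intg_sum => j; apply: L2_mul. Qed.

(** Each squared entry is dominated by the squared norm. *)
Lemma vL2_of_sqn n (X : T -> 'cV[R]_n) :
  (forall j, measurable_fun setT (fun t => X t j 0)) ->
  intg (fun t => sqn (X t)) -> vL2 X.
Proof.
move=> mX h j; split => //; apply: (intg_le _ _ h).
  by have := measurable_funX 2 (mX j).
move=> t; rewrite ger0_norm ?sqr_ge0 // /sqn (bigD1 j) //= lerDl sumr_ge0 //.
by move=> i _; rewrite sqr_ge0.
Qed.

Lemma measurable_sqn n (X : T -> 'cV[R]_n) :
  (forall j, measurable_fun setT (fun t => X t j 0)) ->
  measurable_fun setT (fun t => sqn (X t)).
Proof. by move=> mX; apply: measurable_sum => j; apply: measurable_funX. Qed.

End Expectation.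

(** * Orthogonality from conditional expectations *)

Section Conditioning.
Context {R : realType} {d : measure_display} {T : measurableType d}.
Variable Pr : probability T R.

(** A map with countably many values and measurable fibres stays measurable after
any post-composition, with no regularity asked of it. *)
Lemma measurable_countable_fun (I : countType) (c : T -> I) (h : I -> R) :
  (forall i, measurable (c @^-1` [set i])) -> measurable_fun setT (h \o c).
Proof.
move=> mc _ B mB; rewrite setTI.
have -> : (h \o c) @^-1` B = \bigcup_n
    (if unpickle n is Some i then
       (if `[< B (h i) >] then c @^-1` [set i] else set0) else set0).
  apply/seteqP; split=> [t /= Bt|t [n _]].
    exists (pickle (c t)) => //=; rewrite pickleK /=.
    by rewrite (_ : `[< B (h (c t)) >] = true) //; apply/asboolP.
  case: unpickle => [i|//]; case: asboolP => // Bi /= cti.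
  by rewrite /preimage /= cti.
apply: bigcup_measurable => n _; case: unpickle => [i|//].
by case: asboolP.
Qed.

Lemma floor_fiber (f : T -> R) (e : R) (z : int) : 0 < e ->
  (fun t => Num.floor (f t / e)) @^-1` [set z] =
  f @^-1` `[e * z%:~R, e * (z + 1)%:~R[%classic.
Proof.
move=> e0; apply/seteqP; split=> t /=; rewrite in_itv /=.
  by move=> <-; rewrite ![e * _]mulrC -ler_pdivlMr // -ltr_pdivrMr // floor_itv.
move=> /andP[h1 h2]; apply: floor_def.
by rewrite ler_pdivlMr // ltr_pdivrMr // ![_ * e]mulrC h1.
Qed.

Section Orthogonality.
Variables (G : set (set T)) (f X : T -> R).
Hypothesis Gf : forall B : set R, measurable B -> G (f @^-1` B).
Hypotheses (f2 : L2 Pr f) (X2 : L2 Pr X).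
Hypothesis cX : is_cond_exp Pr G (fun t => (X t)%:E) (cst 0%E).

Lemma cond_zero_integral E : G E -> (\int[Pr]_(t in E) (X t)%:E = 0)%E.
Proof. by case: cX => _ _ h /h <-; rewrite integral0. Qed.

(** [f] is rounded down to a multiple of [e].  The result is constant on each of the
countably many fibres of the rounding, which lie in [G], and [X] has integral 0 on
each of them. *)
Lemma cond_zero_step (e : R) : 0 < e ->
  Ex Pr (fun t => e * (Num.floor (f t / e))%:~R * X t) = 0 /\
  L2 Pr (fun t => e * (Num.floor (f t / e))%:~R).
Proof.
move=> e0; pose c t := Num.floor (f t / e); pose g t := e * (c t)%:~R : R.
have mB z : measurable (`[e * z%:~R, e * (z + 1)%:~R[%classic : set R).
  exact: measurable_itv.
have mc z : measurable (c @^-1` [set z]).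
  rewrite /c floor_fiber //.
  by have := f2.1 measurableT _ (mB z); rewrite setTI.
have mg : measurable_fun setT g.
  exact: (measurable_countable_fun (fun z : int => e * z%:~R) mc).
have g2 : L2 Pr g.
  split => //.
  apply: (intg_le _ _ (intgD (intgZ 2 f2.2) (intg_cst Pr (2 * e ^+ 2)))).
    exact: measurable_funX.
  move=> t; rewrite ger0_norm ?sqr_ge0 //.
  have /andP[h1 h2] := floor_itv (f t / e); rewrite -/(c t) in h1 h2.
  have h1' : g t <= f t by rewrite /g mulrC -ler_pdivlMr.
  have h2' : f t < g t + e.
    by rewrite /g -[X in _ < _ + X]mulr1 -mulrDr -intrD1 mulrC -ltr_pdivrMr.
  move: (g t) h1' h2' => u h1' h2'; have := sqr_ge0 (2 * f t - u).
  have : (f t - u) ^+ 2 <= e ^+ 2 by rewrite ler_sqr ?nnegrE; lra.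
  by lra.
split => //.
have ig := L2_mul g2 X2.
suff h : (\int[Pr]_t (g t * X t)%:E = 0)%E by rewrite /Ex /Rintegral h.
(* Countable additivity is indexed by nat, so the integer fibres are renumbered. *)
pose F n := [set t | pickle (c t) = n].
have FT : \bigcup_n F n = setT.
  by apply/seteqP; split => // t _; exists (pickle (c t)).
have FE n : F n = if unpickle n is Some z then
     (if pickle z == n then c @^-1` [set z] else set0) else set0.
  apply/seteqP; split=> [t /= <-|t /=]; first by rewrite pickleK eqxx.
  by case: unpickle => // z; case: eqP => // <- /= ctz; rewrite /F /= ctz.
rewrite -FT integral_bigcup.
- rewrite eseries0 // => n _ _; rewrite FE.
  case: unpickle => [z|]; last by rewrite integral_set0.
  case: eqP => _; last by rewrite integral_set0.
  rewrite (eq_integral (fun t => (e * z%:~R)%:E * (X t)%:E))%E; last first.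
    by move=> t /set_mem /= ct; rewrite -ct -EFinM.
  rewrite integralZl //.
    by rewrite cond_zero_integral ?mule0 // /c floor_fiber //; apply: Gf.
  by apply: integrableS (L2_intg X2).
- by move=> i j _ _ [t [<- <-]].
- by move=> n; rewrite FE; case: unpickle => // z; case: ifP.
- by rewrite FT.
Qed.

(** Rounding [f] changes it by at most [e], hence the expectation by at most
[e * E|X|], and [e] is arbitrary. *)
Lemma cond_zero_orthogonal : Ex Pr (fun t => f t * X t) = 0.
Proof.
pose C := Ex Pr (fun t => `|X t|).
have iX : intg Pr (fun t => `|X t|).
  apply: (intg_le _ _ (intgD (intg_cst Pr 1) X2.2)).
    exact: measurableT_comp X2.1.
  move=> t; rewrite normr_id -(real_normK (num_real (X t))).
  by move: (normr_ge0 (X t)); nra.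
have C0 : 0 <= C by apply: Ex_ge0.
have step (e : R) : 0 < e -> `|Ex Pr (fun t => f t * X t)| <= e * C.
  move=> e0; have [h g2] := cond_zero_step e0.
  have ifX := L2_mul f2 X2; have igX := L2_mul g2 X2.
  have idX := intgD ifX (intgZ (-1) igX).
  have hle t : `|f t * X t + -1 * (e * (Num.floor (f t / e))%:~R * X t)|
      <= e * `|X t|.
    rewrite mulN1r -mulrBl normrM ler_wpM2r //.
    have /andP[h1 h2] := floor_itv (f t / e).
    rewrite ler_pdivlMr // in h1; rewrite ltr_pdivrMr // intrD in h2.
    by rewrite ger0_norm; lra.
  have -> : Ex Pr (fun t => f t * X t) = Ex Pr (fun t => f t * X t
      + -1 * (e * (Num.floor (f t / e))%:~R * X t)).
    by rewrite ExD ?ExZ ?h ?mulr0 ?addr0 //; apply: intgZ.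
  apply: le_trans (le_normr_Rintegral measurableT idX) _.
  rewrite -ExZ //; apply: Ex_le => //; last exact: intgZ.
  apply: (intg_le _ _ (intgZ e iX)); last by move=> t; rewrite normr_id.
  by apply: measurableT_comp => //; apply: intg_meas idX.
apply/eqP; rewrite -normr_le0; apply/ler_addgt0Pl => e e0; rewrite addr0.
have C1 : 0 < C + 1 by lra.
apply: le_trans (step (e / (C + 1)) _) _; first by rewrite divr_gt0.
by rewrite mulrAC ler_pdivrMr //; nra.
Qed.
End Orthogonality.

Lemma sigma_of_measurable (F : set (T -> R)) :
  (forall f, F f -> measurable_fun setT f) -> sigma_of F `<=` measurable.
Proof.
move=> h; apply: smallest_sub; first exact: sigma_algebra_measurable.
move=> _ [f Ff [B mB <-]]; exact: h Ff measurableT _ mB.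
Qed.

Lemma sigma_of_preimage (F : set (T -> R)) f (B : set R) :
  F f -> measurable B -> sigma_of F (f @^-1` B).
Proof.
move=> Ff mB; apply: sub_sigma_algebra; exists f => //; exists B => //.
by rewrite setTI.
Qed.

(** Integrate the conditional bound over the whole space.  The version [Y] may take
negative values on a null set, hence the passage through its positive part. *)
Lemma cond_exp_bound (F : set (T -> R)) (V W : T -> R) (Y : T -> \bar R) :
  (forall f, F f -> measurable_fun setT f) ->
  is_cond_exp Pr (sigma_of F) (fun t => (V t)%:E) Y ->
  (forall t, 0 <= V t) -> (forall t, 0 <= W t) -> intg Pr W ->
  {ae Pr, forall t, (Y t <= (W t)%:E)%E} ->
  intg Pr V /\ Ex Pr V <= Ex Pr W.
Proof.
move=> mF [hV mY hE] V0 W0 iW YW.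
have mV : measurable_fun setT V.
  apply/measurable_EFinP; case: hV => [h|[]//]; exact: measurable_int h.
have mYT : measurable_fun setT Y.
  move=> _ B mB; rewrite setTI; apply: (sigma_of_measurable mF); exact: mY.
have GT : sigma_of F setT.
  have [g0 gC _] := smallest_sigma_algebra setT
    (\bigcup_(f in F) preimage_set_system setT f measurable).
  by have := gC _ g0; rewrite setD0.
have VW : (\int[Pr]_t (V t)%:E <= \int[Pr]_t (W t)%:E)%E.
  rewrite -hE //; apply: (@le_trans _ _ (\int[Pr]_t (Y^\+ t))%E).
    rewrite integralE -[X in (_ <= X)%E]sube0; apply: leeB => //.
    exact: integral_ge0.
  apply: ae_ge0_le_integral => //.
  - exact: measurable_funepos.
  - by move=> t _; rewrite lee_fin.
  - exact: measurable_int iW.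
  - apply: filterS YW => t YWt _.
    by rewrite funeposE ge_max YWt lee_fin W0.
have iV : intg Pr V.
  apply/integrableP; split; first exact/measurable_EFinP.
  rewrite (eq_integral (fun t => (V t)%:E)); last first.
    by move=> t _; rewrite /= ger0_norm.
  by apply: le_lt_trans VW _; rewrite EFin_Ex // ltry.
by split => //; rewrite -lee_fin -!EFin_Ex.
Qed.

End Conditioning.

(** * The error recursion *)

Section ErrorRecursion.
Context {R : realType} {d : measure_display} {T : measurableType d}.
Variable Pr : probability T R.
Variables (N P : nat) (M : 'I_N -> nat).
Local Notation n := (\sum_k M k)%N.
Variable J : forall k : 'I_N, 'cV[R]_(M k) -> R.
Variables (U : 'M[R]_(n, P)) (Nb : 'I_N -> {set 'I_N}) (A : 'M[R]_n).
Variables (wo : 'cV[R]_n) (X : trajectory R M T).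
Variables (mu gamma : R) (h : 'I_N -> R -> R).
Hypothesis comb : combination_assumption U Nb A.
Hypothesis strat : strategyQ Pr Nb A X mu gamma h.
Hypothesis wo_range : in_range U wo.
Local Notation W := (mixing gamma A).

Definition phi_error i t : 'cV[R]_n := wo - \mxcol_k phi X k i t.
Definition psi_error i t : 'cV[R]_n := wo - \mxcol_k psi X k i t.
Definition wgt_error i t : 'cV[R]_n := wo - \mxcol_k wgt X k i t.
Definition grad_hat i t : 'cV[R]_n := \mxcol_k ghat X i t (wgt X k i.-1 t).
Definition noise i t : 'cV[R]_n := \mxcol_k grad_noise J X k i t.
Definition qerr i t : 'cV[R]_n := \mxcol_k quant_error X h k i t.
Definition qinput i t : 'cV[R]_n := \mxcol_k chi X k i t.

Lemma submxcolZ (c : R) (x : 'cV[R]_n) k : submxcol (c *: x) k = c *: submxcol x k.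
Proof. by apply/matrixP => i j; rewrite !mxE. Qed.

Lemma submxcol_mulmx (D : 'M[R]_n) (x : 'cV[R]_n) k :
  submxcol (D *m x) k = \sum_l submxblock D k l *m submxcol x l.
Proof.
rewrite -[D in LHS]submxblockK -[x in LHS]submxcolK mxblockEv mxcol_mul mxcolK.
by rewrite mul_mxrow_mxcol.
Qed.

Lemma mixing_fix : W *m wo = wo.
Proof.
have [x ->] := wo_range.
rewrite mulmxDl -!scalemxAl mul1mx [A *m _]mulmxA (comb_right comb).
by rewrite -scalerDl subrK scale1r.
Qed.

Lemma mixing_left : U^T *m W = U^T.
Proof.
by rewrite mulmxDr -!scalemxAr mulmx1 (comb_left comb) -scalerDl subrK scale1r.
Qed.

(** The mixing matrix fixes [wo], which lies in the range of [U], so it acts on the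
error itself. *)
Lemma wgt_errorE i t : wgt_error i t = W *m phi_error i t.
Proof.
rewrite mulmxBr mixing_fix; congr (_ - _).
rewrite mulmxDl -!scalemxAl mul1mx -[RHS]submxcolK; apply: eq_mxcol => k.
rewrite (strat_wgt strat) submxcolD; congr (_ + _).
  by rewrite submxcolZ mxcolK.
rewrite submxcolZ; congr (_ *: _); rewrite submxcol_mulmx.
rewrite [RHS](bigID (mem (Nb k))) /= [X in _ + X]big1 ?addr0.
  by apply: eq_bigr => l _; rewrite mxcolK.
by move=> l hl; rewrite (comb_sparse comb hl) mul0mx.
Qed.

Lemma psi_errorE i t : (0 < i)%N ->
  psi_error i t = W *m phi_error i.-1 t + mu *: grad_hat i t.
Proof.
move=> i0; rewrite -wgt_errorE /psi_error /wgt_error /grad_hat.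
rewrite (_ : (\mxcol_k psi X k i t) =
    \mxcol_k wgt X k i.-1 t - mu *: \mxcol_k ghat X i t (wgt X k i.-1 t)).
  by rewrite opprB addrCA addrC.
rewrite -[RHS]submxcolK; apply: eq_mxcol => k.
by rewrite submxcolB submxcolZ !mxcolK (strat_psi strat).
Qed.

Lemma qinputE i t : (0 < i)%N ->
  qinput i t = phi_error i.-1 t - W *m phi_error i.-1 t - mu *: grad_hat i t.
Proof.
move=> i0; rewrite -addrA -opprD -psi_errorE // /phi_error /psi_error opprB.
by rewrite addrC addrA subrK /qinput /chi mxcolB.
Qed.

Lemma phi_errorE i t : (0 < i)%N -> phi_error i t = psi_error i t + qerr i t.
Proof.
move=> i0; rewrite /phi_error /psi_error /qerr -addrA; congr (_ + _).
rewrite (_ : (\mxcol_k phi X k i t) =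
  \mxcol_k psi X k i t - \mxcol_k quant_error X h k i t); first by rewrite opprB addrC.
rewrite -mxcolB; apply: eq_mxcol => k.
rewrite (strat_phi strat) // /quant_error /chi.
move: (phi _ _ _ _) (psi _ _ _ _) (quantized _ _ _ _ _) => a b c.
by apply/matrixP => p q; rewrite !mxE; ring.
Qed.

Lemma noiseE i t :
  noise i t = grad_stack J (wo - wgt_error i.-1 t) - grad_hat i t.
Proof.
rewrite /noise /wgt_error opprB [wo + _]addrC subrK.
by rewrite /grad_stack -mxcolB; apply: eq_mxcol => k; rewrite mxcolK.
Qed.

End ErrorRecursion.

Section Uncorrelated.
Context {R : realType} {d : measure_display} {T : measurableType d}.
Variable Pr : probability T R.

Definition uncorrelated n (F Y : T -> 'cV[R]_n) :=
  forall a b, Ex Pr (fun t => F t a 0 * Y t b 0) = 0.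

Lemma Ex_dotv_uncorrelated m n (B : 'M[R]_(m, n)) (F Y : T -> 'cV[R]_n) :
  vL2 Pr F -> vL2 Pr Y -> uncorrelated F Y ->
  Ex Pr (fun t => dotv (B *m F t) (B *m Y t)) = 0.
Proof.
move=> hF hY h0; pose D := B^T *m B.
have iD a b : intg Pr (fun t => D a b * (F t a 0 * Y t b 0)).
  by apply: intgZ; apply: L2_mul; [exact: hF|exact: hY].
have -> : (fun t => dotv (B *m F t) (B *m Y t)) =
    (fun t => \sum_a \sum_b D a b * (F t a 0 * Y t b 0)).
  apply/funext => t; rewrite dotv_mulmxl mulmxA -/D.
  by apply: eq_bigr => a _; rewrite mxE mulr_sumr; apply: eq_bigr => b _; rewrite mulrCA.
rewrite Ex_sum; last by move=> a; apply: intg_sum => b; exact: iD.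
rewrite big1 // => a _; rewrite Ex_sum // big1 // => b _.
by rewrite ExZ ?h0 ?mulr0 //; apply: L2_mul; [exact: hF|exact: hY].
Qed.

(** Pythagoras: the cross term is a linear combination of vanishing correlations. *)
Lemma Ex_sqn_uncorrelated m n (B : 'M[R]_(m, n)) (F Y : T -> 'cV[R]_n) :
  vL2 Pr F -> vL2 Pr Y -> uncorrelated F Y ->
  Ex Pr (fun t => sqn (B *m (F t + Y t))) =
  Ex Pr (fun t => sqn (B *m F t)) + Ex Pr (fun t => sqn (B *m Y t)).
Proof.
move=> hF hY h0.
have iF := intg_sqn (vL2_mulmx B hF); have iY := intg_sqn (vL2_mulmx B hY).
have iD := intg_dotv (vL2_mulmx B hF) (vL2_mulmx B hY).
have -> : (fun t => sqn (B *m (F t + Y t))) =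
   (fun t => sqn (B *m F t) + 2 * dotv (B *m F t) (B *m Y t) + sqn (B *m Y t)).
  by apply/funext => t; rewrite mulmxDr sqnD mulr_natl.
have iD2 := intgZ 2 iD.
rewrite (ExD (intgD iF iD2) iY) (ExD iF iD2) (ExZ _ iD).
by rewrite Ex_dotv_uncorrelated // mulr0 addr0.
Qed.

Lemma cond_zero_measurable (G : set (set T)) (Z : T -> R) :
  is_cond_exp Pr G (fun t => (Z t)%:E) (cst 0%E) -> measurable_fun setT Z.
Proof.
by case=> [[h|[h _]] _ _]; apply/measurable_EFinP => //; exact: measurable_int h.
Qed.

Lemma measurable_submxcol p (s : 'I_p -> nat) (V : T -> 'cV[R]_(\sum_k s k)) k :
  vL2 Pr V -> vL2 Pr (fun t => submxcol (V t) k).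
Proof.
move=> hV j; have := hV (tagnat.Rank k j).
by congr L2; apply/funext => t; rewrite mxE.
Qed.

End Uncorrelated.

Section SquareIntegrability.
Context {R : realType} {d : measure_display} {T : measurableType d}.
Variable Pr : probability T R.
Variables (N P : nat) (M : 'I_N -> nat).
Local Notation n := (\sum_k M k)%N.
Variable J : forall k : 'I_N, 'cV[R]_(M k) -> R.
Variables (U : 'M[R]_(n, P)) (Nb : 'I_N -> {set 'I_N}) (A : 'M[R]_n).
Variables (wo : 'cV[R]_n) (X : trajectory R M T).
Variables (mu gamma : R) (h : 'I_N -> R -> R).
Hypothesis comb : combination_assumption U Nb A.
Hypothesis strat : strategyQ Pr Nb A X mu gamma h.
Hypothesis wo_range : in_range U wo.
Variables (bs2 ss2 bq2 sq2 : 'I_N -> R).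
Hypothesis gn : gradient_noise_assumption Pr J wo X bs2 ss2.
Hypothesis qm : quantization_mechanism Pr X h bq2 sq2.
Hypothesis bq2_ge0 : forall k, 0 <= bq2 k.
Hypothesis sq2_ge0 : forall k, 0 <= sq2 k.
Local Notation W := (mixing gamma A).
Variable L : R.
Hypothesis lipschitz : forall x y,
  sqn (grad_stack J x - grad_stack J y) <= L ^+ 2 * sqn (x - y).
Local Notation xerr := (phi_error wo X).
Local Notation yerr := (psi_error wo X).
Local Notation werr := (wgt_error wo X).
Local Notation gh := (grad_hat X).
Local Notation sn := (noise J X).
Local Notation qe := (qerr X h).
Local Notation qi := (qinput X).

Lemma phi_measurable i l j : vL2 Pr (xerr i) ->
  measurable_fun setT (fun t => phi X l i t j 0).
Proof.
move=> hx; have [+ _] := measurable_submxcol (k := l) (vL2B (vL2_cst Pr wo) hx) j.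
by congr measurable_fun; apply/funext => t; rewrite opprB [wo + _]addrC subrK mxcolK.
Qed.

Lemma psi_measurable i l j : vL2 Pr (yerr i) ->
  measurable_fun setT (fun t => psi X l i t j 0).
Proof.
move=> hx; have [+ _] := measurable_submxcol (k := l) (vL2B (vL2_cst Pr wo) hx) j.
by congr measurable_fun; apply/funext => t; rewrite opprB [wo + _]addrC subrK mxcolK.
Qed.

(** The noise entries are measurable because they possess a conditional
expectation; the conditional variance bound is then integrated. *)
Lemma noise_moment i : (0 < i)%N -> vL2 Pr (xerr i.-1) ->
  vL2 Pr (sn i) /\
  Ex Pr (fun t => sqn (sn i t)) <=
  Ex Pr (fun t => \sum_k (bs2 k * sqn (submxcol (werr i.-1 t) k) + ss2 k)).
Proof.
move=> i0 hx.
have hw : vL2 Pr (werr i.-1).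
  have := vL2_mulmx W hx; congr vL2; apply/funext => t.
  by rewrite (wgt_errorE comb strat).
have iW k : intg Pr (fun t => bs2 k * sqn (submxcol (werr i.-1 t) k) + ss2 k).
  by apply: intgD; [apply: intgZ; apply: intg_sqn; exact: measurable_submxcol|exact: intg_cst].
have hk k : intg Pr (fun t => sqn (grad_noise J X k i t)) /\
   Ex Pr (fun t => sqn (grad_noise J X k i t)) <=
   Ex Pr (fun t => bs2 k * sqn (submxcol (werr i.-1 t) k) + ss2 k).
  have [Y hY YW] := gn_var gn k i0; have [b0 s0] := gn_ge0 gn k.
  apply: (@cond_exp_bound _ _ _ _ (\bigcup_l entries (phi X l i.-1)) _ _ Y) => //.
  - move=> f [l _ [j _ <-]]; exact: phi_measurable.
  - by move: hY; congr is_cond_exp; apply/funext => t; rewrite norm2_sqr.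
  - by move=> t; apply: sqn_ge0.
  - by move=> t; rewrite addr_ge0 // mulr_ge0 ?sqn_ge0.
  - apply: filterS YW => t; rewrite norm2_sqr.
    by rewrite /wgt_error submxcolB mxcolK.
have mk k : vL2 Pr (grad_noise J X k i).
  apply: vL2_of_sqn => [j|]; last by have [] := hk k.
  exact: cond_zero_measurable (gn_mean gn j i0).
split; first exact: vL2_mxcol.
have -> : (fun t => sqn (sn i t)) = (fun t => \sum_k sqn (grad_noise J X k i t)).
  by apply/funext => t; rewrite sqn_mxcol.
rewrite !Ex_sum //; last by move=> k; have [] := hk k.
by apply: ler_sum => k _; have [] := hk k.
Qed.

(** The true gradient along the iterates is the sum of the noise and of the
stochastic gradient, both measurable, and the Lipschitz bound makes it square
integrable. *)
Lemma grad_moment i : (0 < i)%N -> vL2 Pr (xerr i.-1) ->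
  vL2 Pr (fun t => grad_stack J (wo - werr i.-1 t)) /\ vL2 Pr (gh i).
Proof.
move=> i0 hx; have [hs _] := noise_moment i0 hx.
have mg p : measurable_fun setT (fun t => gh i t p 0).
  have := strat_ghat_meas strat (tagnat.sig2 p) i0.
  by congr measurable_fun; apply/funext => t; rewrite mxE.
have hG : vL2 Pr (fun t => grad_stack J (wo - werr i.-1 t)).
  have mG p : measurable_fun setT (fun t => grad_stack J (wo - werr i.-1 t) p 0).
    have := measurable_funD (hs p).1 (mg p).
    by congr measurable_fun; apply/funext => t; rewrite /= (noiseE J wo);
      move: (grad_stack _ _) (gh i t) => u w; rewrite !mxE subrK.
  apply: vL2_of_sqn => //.
  have iw := intgZ (2 * L ^+ 2) (intg_sqn (vL2_mulmx W hx)).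
  apply: (intg_le _ _ (intgD (intg_cst Pr (2 * sqn (grad_stack J wo))) iw)).
    exact: measurable_sqn.
  move=> t; rewrite ger0_norm ?sqn_ge0 // (wgt_errorE comb strat) //.
  set g := grad_stack J _.
  have := sqnD_le (g - grad_stack J wo) (grad_stack J wo); rewrite subrK.
  have := lipschitz (wo - W *m xerr i.-1 t) wo.
  by rewrite [wo - _ - wo]addrC addKr sqnN -/g; lra.
split => //; have := vL2B hG hs.
congr vL2; apply/funext => t; rewrite (noiseE J wo).
by move: (grad_stack _ _) (gh i t) => u w; rewrite opprB addrC subrK.
Qed.

Lemma vL2_psi_error i : (0 < i)%N -> vL2 Pr (xerr i.-1) -> vL2 Pr (yerr i).
Proof.
move=> i0 hx; have [_ hg] := grad_moment i0 hx.
have := vL2D (vL2_mulmx W hx) (vL2Z mu hg).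
by congr vL2; apply/funext => t; rewrite (psi_errorE comb strat).
Qed.

Lemma vL2_qinput i : (0 < i)%N -> vL2 Pr (xerr i.-1) -> vL2 Pr (qi i).
Proof.
move=> i0 hx; have [_ hg] := grad_moment i0 hx.
have := vL2B (vL2B hx (vL2_mulmx W hx)) (vL2Z mu hg).
by congr vL2; apply/funext => t; rewrite (qinputE comb strat wo_range).
Qed.

Lemma qerr_moment i : (0 < i)%N -> (forall j, (j < i)%N -> vL2 Pr (xerr j)) ->
  vL2 Pr (qe i) /\
  Ex Pr (fun t => sqn (qe i t)) <=
  Ex Pr (fun t => \sum_k (bq2 k * sqn (submxcol (qi i t) k) + sq2 k)).
Proof.
move=> i0 hx.
have hi : vL2 Pr (qi i) by apply: vL2_qinput => //; apply: hx; rewrite prednK.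
have iW k : intg Pr (fun t => bq2 k * sqn (submxcol (qi i t) k) + sq2 k).
  by apply: intgD; [apply: intgZ; apply: intg_sqn; exact: measurable_submxcol|exact: intg_cst].
have hk k : intg Pr (fun t => sqn (quant_error X h k i t)) /\
   Ex Pr (fun t => sqn (quant_error X h k i t)) <=
   Ex Pr (fun t => bq2 k * sqn (submxcol (qi i t) k) + sq2 k).
  have [Y [hY _ YW]] := qm_var qm k i0.
  apply: (@cond_exp_bound _ _ _ _ (\bigcup_l
    ((\bigcup_(j in [set j | (j < i)%N]) entries (phi X l j)) `|`
     (\bigcup_(j in [set j | (1 <= j <= i)%N]) entries (psi X l j)))) _ _ Y) => //.
  - move=> f [l _ [[j /= ji [p _ <-]]|[j /= /andP[j0 ji] [p _ <-]]]].
      by apply: phi_measurable; exact: hx.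
    apply: psi_measurable; apply: vL2_psi_error => //; apply: hx.
    by rewrite prednK.
  - by move: hY; congr is_cond_exp; apply/funext => t; rewrite norm2_sqr.
  - by move=> t; apply: sqn_ge0.
  - by move=> t; rewrite addr_ge0 // mulr_ge0 ?sqn_ge0.
  - by apply: filterS YW => t; rewrite norm2_sqr mxcolK.
have mk k : vL2 Pr (quant_error X h k i).
  apply: vL2_of_sqn => [j|]; last by have [] := hk k.
  exact: cond_zero_measurable (qm_mean qm j i0).1.
split; first exact: vL2_mxcol.
have -> : (fun t => sqn (qe i t)) = (fun t => \sum_k sqn (quant_error X h k i t)).
  by apply/funext => t; rewrite sqn_mxcol.
rewrite !Ex_sum //; last by move=> k; have [] := hk k.
by apply: ler_sum => k _; have [] := hk k.
Qed.

(** Strong induction: the conditioning on the whole history requires all earlier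
iterates to be measurable. *)
Lemma vL2_phi_error i : vL2 Pr (xerr i).
Proof.
have [m] := ubnP i; elim: m i => // m IH [|i] im.
  apply: vL2B; first exact: vL2_cst.
  apply: vL2_mxcol => k; apply: vL2_of_sqn.
    by move=> j; exact: (strat_phi0_meas strat).
  have := strat_phi0_moment strat k; congr (_.-integrable _ _).
  by apply/funext => t; rewrite norm2_sqr.
have hx j : (j < i.+1)%N -> vL2 Pr (xerr j).
  by move=> ji; apply: IH; apply: leq_trans ji _.
have := vL2D (vL2_psi_error (ltn0Sn i) (hx _ (ltnSn i))) (qerr_moment (ltn0Sn i) hx).1.
by congr vL2; apply/funext => t; rewrite (phi_errorE wo strat).
Qed.

(** The entries of [phi] generate the conditioning sigma-algebra, and an entry of the
error is an affine function of one of them. *)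
Lemma noise_uncorrelated i : (0 < i)%N -> uncorrelated Pr (xerr i.-1) (sn i).
Proof.
move=> i0 a b; have hx := vL2_phi_error i.-1.
apply: (@cond_zero_orthogonal _ _ _ _ (sigma_phi X i.-1)).
- move=> B mB; rewrite (_ : _ @^-1` B =
    (fun t => phi X (tagnat.sig1 a) i.-1 t (tagnat.sig2 a) 0) @^-1`
      ((fun y => wo a 0 - y) @^-1` B)).
    apply: sigma_of_preimage.
      by exists (tagnat.sig1 a) => //; exists (tagnat.sig2 a).
    rewrite -[X in measurable X]setTI.
    by apply: (measurable_funB (measurable_cst _) (@measurable_id _ _ setT)).
  by apply/seteqP; split=> t /=; rewrite /phi_error !mxE.
- exact: hx.
- exact: (noise_moment i0 hx).1.
- have := gn_mean gn (tagnat.sig2 b) i0; congr is_cond_exp.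
  by apply/funext => t; rewrite [in RHS]mxE.
Qed.

Lemma qerr_uncorrelated i : (0 < i)%N -> uncorrelated Pr (yerr i) (qe i).
Proof.
move=> i0 a b; have hx := vL2_phi_error.
apply: (@cond_zero_orthogonal _ _ _ _ (sigma_hist X i)).
- move=> B mB; rewrite (_ : _ @^-1` B =
    (fun t => psi X (tagnat.sig1 a) i t (tagnat.sig2 a) 0) @^-1`
      ((fun y => wo a 0 - y) @^-1` B)).
    apply: sigma_of_preimage.
      exists (tagnat.sig1 a) => //; right; exists i; first by rewrite /= i0 leqnn.
      by exists (tagnat.sig2 a).
    rewrite -[X in measurable X]setTI.
    by apply: (measurable_funB (measurable_cst _) (@measurable_id _ _ setT)).
  by apply/seteqP; split=> t /=; rewrite /psi_error !mxE.
- exact: vL2_psi_error.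
- exact: (qerr_moment i0 (fun j _ => hx j)).1.
- have := (qm_mean qm (tagnat.sig2 b) i0).1; congr is_cond_exp.
  by apply/funext => t; rewrite [in RHS]mxE.
Qed.

End SquareIntegrability.

(** * Recursions for the second moments *)

Section MomentRecursion.
Context {R : realType} {d : measure_display} {T : measurableType d}.
Variable Pr : probability T R.
Variables (N P : nat) (M : 'I_N -> nat).
Local Notation n := (\sum_k M k)%N.
Variable J : forall k : 'I_N, 'cV[R]_(M k) -> R.
Variables (U : 'M[R]_(n, P)) (Nb : 'I_N -> {set 'I_N}) (A : 'M[R]_n).
Variables (wo : 'cV[R]_n) (X : trajectory R M T).
Variables (mu gamma : R) (h : 'I_N -> R -> R).
Hypothesis comb : combination_assumption U Nb A.
Hypothesis strat : strategyQ Pr Nb A X mu gamma h.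
Hypothesis wo_range : in_range U wo.
Variables (bs2 ss2 bq2 sq2 : 'I_N -> R).
Hypothesis gn : gradient_noise_assumption Pr J wo X bs2 ss2.
Hypothesis qm : quantization_mechanism Pr X h bq2 sq2.
Hypothesis bq2_ge0 : forall k, 0 <= bq2 k.
Hypothesis sq2_ge0 : forall k, 0 <= sq2 k.
Local Notation W := (mixing gamma A).
Variable L : R.
Hypothesis lipschitz : forall x y,
  sqn (grad_stack J x - grad_stack J y) <= L ^+ 2 * sqn (x - y).
Local Notation xerr := (phi_error wo X).
Local Notation yerr := (psi_error wo X).
Local Notation werr := (wgt_error wo X).
Local Notation gh := (grad_hat X).
Local Notation sn := (noise J X).
Local Notation qe := (qerr X h).
Local Notation qi := (qinput X).


Variables (m : nat) (K : 'M[R]_(m, n)) (v q dl C l : R).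
Hypothesis v_ge0 : 0 <= v.
Hypothesis mu_gt0 : 0 < mu.
Hypothesis KW : forall x, sqn (K *m (W *m x)) <= (1 - dl) * sqn (K *m x).
Hypothesis Kv : forall x, sqn (K *m x) <= v * sqn x.
Hypothesis Uv : forall x, sqn (U^T *m x) <= v * sqn x.
Hypothesis Kq : forall x, sqn (x - W *m x) <= q * sqn (K *m x).
Hypothesis C_ge0 : 0 <= C.
Hypothesis drift : forall x : 'cV[R]_n,
  [/\ sqn (W *m x) <= C * (sqn (U^T *m x) + sqn (K *m x)),
      sqn (grad_stack J (wo - W *m x)) <=
        C * (1 + sqn (U^T *m x) + sqn (K *m x)) &
      dotv (U^T *m x) (U^T *m grad_stack J (wo - W *m x)) *+ 2
        <= - l * sqn (U^T *m x) + C * (1 + sqn (K *m x))].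
Variable bq : R.
Hypothesis bq_max : forall k, bq2 k <= bq.

Definition centroid_moment i := Ex Pr (fun t => sqn (U^T *m xerr i t)).
Definition disagreement_moment i := Ex Pr (fun t => sqn (K *m xerr i t)).
Definition input_moment i := Ex Pr (fun t => sqn (qi i t)).
Definition qerr_second_moment i := Ex Pr (fun t => sqn (qe i t)).
Definition grad_second_moment i := Ex Pr (fun t => sqn (gh i t)).
Local Notation a := centroid_moment.
Local Notation b := disagreement_moment.
Local Notation c := input_moment.
Local Notation z := qerr_second_moment.
Local Notation g := grad_second_moment.

Let hx i : vL2 Pr (xerr i).
Proof. exact: (vL2_phi_error comb strat wo_range gn qm bq2_ge0 sq2_ge0 lipschitz). Qed.
Let hs i (i0 : (0 < i)%N) := noise_moment comb strat wo_range gn i0 (hx i.-1).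
Let hg i (i0 : (0 < i)%N) := grad_moment comb strat wo_range gn lipschitz i0 (hx i.-1).
Let hy i (i0 : (0 < i)%N) := vL2_psi_error comb strat wo_range gn lipschitz i0 (hx i.-1).
Let hc i (i0 : (0 < i)%N) := vL2_qinput comb strat wo_range gn lipschitz i0 (hx i.-1).
Let hz i (i0 : (0 < i)%N) := qerr_moment comb strat wo_range gn qm bq2_ge0 sq2_ge0
  lipschitz i0 (fun j _ => hx j).
Let ia i : intg Pr (fun t => sqn (U^T *m xerr i t)).
Proof. by apply: intg_sqn; apply: vL2_mulmx. Qed.
Let ib i : intg Pr (fun t => sqn (K *m xerr i t)).
Proof. by apply: intg_sqn; apply: vL2_mulmx. Qed.

Lemma sum_submxcol_le (f e : 'I_N -> R) (B : R) (x : 'cV[R]_n) :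
  (forall k, f k <= B) ->
  \sum_k (f k * sqn (submxcol x k) + e k) <= B * sqn x + \sum_k e k.
Proof.
move=> fB; rewrite big_split /= lerD2r -{2}[x]submxcolK sqn_mxcol mulr_sumr.
by apply: ler_sum => k _; rewrite ler_wpM2r ?sqn_ge0.
Qed.

(** The stochastic gradient is the true gradient minus the noise; both have second
moments controlled by the current error. *)
Lemma grad_moment_le i : (0 < i)%N ->
  g i <= (2 * C + 2 * (\sum_k bs2 k) * C + 2 * \sum_k ss2 k) *
         (1 + a i.-1 + b i.-1).
Proof.
move=> i0; set Bs := \sum_k bs2 k; set Ss := \sum_k ss2 k.
have Bs0 : 0 <= Bs by apply: sumr_ge0 => k _; have [] := gn_ge0 gn k.
have Ss0 : 0 <= Ss by apply: sumr_ge0 => k _; have [] := gn_ge0 gn k.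
have a0 : 0 <= a i.-1 by apply: Ex_ge0 => t; apply: sqn_ge0.
have b0 : 0 <= b i.-1 by apply: Ex_ge0 => t; apply: sqn_ge0.
have iab := intgD (ia i.-1) (ib i.-1).
have iG := intg_sqn (hg i0).1.
have isn := intg_sqn (hs i0).1.
have h1 : Ex Pr (fun t => sqn (sn i t)) <= Bs * (C * (a i.-1 + b i.-1)) + Ss.
  apply: le_trans (hs i0).2 _.
  apply: (@le_trans _ _ (Ex Pr (fun t => Bs * C *
      (sqn (U^T *m xerr i.-1 t) + sqn (K *m xerr i.-1 t)) + Ss))).
    apply: Ex_le.
    - apply: intg_sum => k; apply: intgD; last exact: intg_cst.
      apply: intgZ; apply: intg_sqn; apply: measurable_submxcol.
      have := vL2_mulmx W (hx i.-1); congr vL2; apply/funext => t.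
      by rewrite (wgt_errorE comb strat).
    - by apply: intgD; [exact: intgZ|exact: intg_cst].
    - move=> t; apply: le_trans (sum_submxcol_le (B := Bs) _ _ _) _.
        move=> k; rewrite /Bs (bigD1 k) //= lerDl; apply: sumr_ge0 => j _.
        by have [] := gn_ge0 gn j.
      rewrite lerD2r -mulrA ler_wpM2l // (wgt_errorE comb strat) //.
      by have [] := drift (xerr i.-1 t).
  by rewrite ExD ?ExZ ?ExD ?Ex_cst ?mulrA //; [exact: intgZ|exact: intg_cst].
have h2 : Ex Pr (fun t => sqn (grad_stack J (wo - werr i.-1 t))) <=
   C * (1 + a i.-1 + b i.-1).
  apply: (@le_trans _ _ (Ex Pr (fun t => C + C *
      (sqn (U^T *m xerr i.-1 t) + sqn (K *m xerr i.-1 t))))).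
    apply: Ex_le => //.
      by apply: intgD; [exact: intg_cst|exact: intgZ].
    move=> t; rewrite (wgt_errorE comb strat) //.
    by have [_ + _] := drift (xerr i.-1 t); rewrite -addrA mulrDr mulr1.
  rewrite ExD ?ExZ ?ExD ?Ex_cst //; [|exact: intg_cst|exact: intgZ].
  by rewrite -addrA [X in _ <= X]mulrDr mulr1.
have h3 : g i <= 2 * Ex Pr (fun t => sqn (grad_stack J (wo - werr i.-1 t))) +
    2 * Ex Pr (fun t => sqn (sn i t)).
  rewrite -!ExZ // -ExD; [|exact: intgZ|exact: intgZ].
  apply: Ex_le; first exact: intg_sqn (hg i0).2.
    by apply: intgD; exact: intgZ.
  move=> t; rewrite -[X in sqn X <= _](_ : grad_stack J (wo - werr i.-1 t) - sn i t = _).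
    exact: sqnB_le.
  by rewrite (noiseE J wo); move: (grad_stack _ _) (gh i t) => u w; rewrite opprB addrC subrK.
have BC : 0 <= Bs * C by rewrite mulr_ge0.
have Sab : 0 <= Ss * (a i.-1 + b i.-1) by rewrite mulr_ge0 // addr_ge0.
by apply: le_trans h3 _; lra.
Qed.

Lemma input_moment_le i : (0 < i)%N ->
  c i <= 2 * q * b i.-1 + 2 * mu ^+ 2 * g i.
Proof.
move=> i0; have ig := intg_sqn (hg i0).2.
rewrite -!ExZ // -ExD; [|exact: intgZ|exact: intgZ].
apply: Ex_le; first exact: intg_sqn (hc i0).
  by apply: intgD; exact: intgZ.
move=> t; rewrite (qinputE comb strat wo_range) //.
apply: le_trans (sqnB_le _ _) _; rewrite sqnZ -!mulrA lerD2r ler_wpM2l //.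
Qed.

Lemma qerr_moment_le i : (0 < i)%N -> z i <= bq * c i + \sum_k sq2 k.
Proof.
move=> i0; have ic := intg_sqn (hc i0); apply: le_trans (hz i0).2 _.
rewrite -ExZ // -[X in _ + X](Ex_cst Pr) -ExD; [|exact: intgZ|exact: intg_cst].
apply: Ex_le.
- apply: intg_sum => k; apply: intgD; last exact: intg_cst.
  by apply: intgZ; apply: intg_sqn; apply: measurable_submxcol; exact: hc.
- by apply: intgD; [exact: intgZ|exact: intg_cst].
- by move=> t; apply: sum_submxcol_le.
Qed.

(** The quantization error is uncorrelated with the error before quantization. *)
Lemma phi_moment_split p (D : 'M[R]_(p, n)) i : (0 < i)%N ->
  Ex Pr (fun t => sqn (D *m xerr i t)) =
  Ex Pr (fun t => sqn (D *m yerr i t)) + Ex Pr (fun t => sqn (D *m qe i t)).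
Proof.
move=> i0; rewrite -(Ex_sqn_uncorrelated D (hy i0) (hz i0).1).
  by congr Ex; apply/funext => t; rewrite (phi_errorE wo strat).
exact: (qerr_uncorrelated comb strat wo_range gn qm bq2_ge0 sq2_ge0 lipschitz).
Qed.

(** The gradient step is treated as a perturbation of size [mu]: Young's inequality
keeps the contraction up to the factor [1 + s]. *)
Lemma disagreement_moment_le (s : R) i : 0 < s -> (0 < i)%N ->
  b i <= (1 + s) * (1 - dl) * b i.-1 + (1 + s^-1) * mu ^+ 2 * v * g i + v * z i.
Proof.
move=> s0 i0; rewrite /b phi_moment_split //.
have ig := intg_sqn (hg i0).2; have iz := intg_sqn (hz i0).1.
apply: lerD; last first.
  rewrite -ExZ //; apply: Ex_le; [|exact: intgZ|by move=> t; apply: Kv].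
  by apply: intg_sqn; apply: vL2_mulmx; exact: (hz i0).1.
rewrite -!ExZ // -ExD; [|exact: intgZ|exact: intgZ].
apply: Ex_le.
- by apply: intg_sqn; apply: vL2_mulmx; exact: hy.
- by apply: intgD; exact: intgZ.
move=> t; rewrite (psi_errorE comb strat) // mulmxDr -scalemxAr.
apply: le_trans (sqn_young _ _ s0) _; rewrite sqnZ -!mulrA.
have s1 : 0 <= 1 + s^-1 by rewrite addr_ge0 // invr_ge0 ltW.
apply: lerD; rewrite ler_wpM2l //; first lra.
by rewrite !ler_wpM2l // ltW.
Qed.

(** Mixing leaves the centroid unchanged, so the contraction comes from the drift of
order [mu]; the term of order [mu] in the gradient noise has zero mean. *)
Lemma centroid_moment_le i : (0 < i)%N ->
  a i <= a i.-1 + mu * (- l * a i.-1 + C * (1 + b i.-1)) + mu ^+ 2 * v * g i + v * z i.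
Proof.
move=> i0; rewrite /a phi_moment_split //.
have ig := intg_sqn (hg i0).2; have iz := intg_sqn (hz i0).1.
have id := intg_dotv (vL2_mulmx U^T (hx i.-1)) (vL2_mulmx U^T (hs i0).1).
have d0 := Ex_dotv_uncorrelated U^T (hx i.-1) (hs i0).1
  (noise_uncorrelated comb strat wo_range gn qm bq2_ge0 sq2_ge0 lipschitz i0).
apply: lerD; last first.
  rewrite -ExZ //; apply: Ex_le; [|exact: intgZ|by move=> t; apply: Uv].
  by apply: intg_sqn; apply: vL2_mulmx; exact: (hz i0).1.
pose f t := sqn (U^T *m xerr i.-1 t); pose k t := sqn (K *m xerr i.-1 t).
pose e t := dotv (U^T *m xerr i.-1 t) (U^T *m sn i t).
have i1 := intgZ (1 - mu * l) (ia i.-1); have i2 := intgZ (mu * C) (ib i.-1).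
have i3 := intgZ (- (2 * mu)) id; have i4 := intgZ (mu ^+ 2 * v) ig.
have i5 := intgD (intgD (intgD (intgD i1 i2) i3) i4) (intg_cst Pr (mu * C)).
apply: (@le_trans _ _ (Ex Pr (fun t => (1 - mu * l) * f t + mu * C * k t
    + - (2 * mu) * e t + mu ^+ 2 * v * sqn (gh i t) + mu * C))).
  apply: Ex_le => //.
    by apply: intg_sqn; apply: vL2_mulmx; exact: hy.
  move=> t; rewrite (psi_errorE comb strat) // mulmxDr mulmxA.
  rewrite (mixing_left gamma comb) -scalemxAr sqnD sqnZ dotvZr -/(f t).
  have [_ _ hd] := drift (xerr i.-1 t).
  have -> : dotv (U^T *m xerr i.-1 t) (U^T *m gh i t) =
      dotv (U^T *m xerr i.-1 t) (U^T *m grad_stack J (wo - W *m xerr i.-1 t)) - e t.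
    rewrite -dotvBr -mulmxBr; congr dotv; congr mulmx.
    rewrite -(wgt_errorE comb strat) // (noiseE J wo).
    by move: (grad_stack _ _) (gh i t) => u w; rewrite opprB addrC subrK.
  set gg := gh i t.
  have h1 : mu ^+ 2 * sqn (U^T *m gg) <= mu ^+ 2 * (v * sqn gg).
    by rewrite ler_wpM2l ?sqr_ge0.
  rewrite -(ler_pM2l mu_gt0) -/(f t) -/(k t) in hd.
  by move: (f t) (k t) (e t) hd h1 => ? ? ? hd h1; lra.
rewrite (ExD (intgD (intgD (intgD i1 i2) i3) i4) (intg_cst _ _)).
rewrite (ExD (intgD (intgD i1 i2) i3) i4) (ExD (intgD i1 i2) i3) (ExD i1 i2).
rewrite (ExZ _ (ia _)) (ExZ _ (ib _)) (ExZ _ id) (ExZ _ ig) Ex_cst d0 /a /b /g.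
by lra.
Qed.

End MomentRecursion.

(** * Steady-state analysis of the moment recursions *)

Section SequenceBounds.
Variable R : realType.

(** The excess over the fixed point [k / rho] decays geometrically. *)
Lemma contraction_eventually (u : nat -> R) (rho k e : R) (i0 : nat) :
  0 < rho <= 1 -> 0 < e ->
  (forall i, (i0 <= i)%N -> u i.+1 <= (1 - rho) * u i + k) ->
  exists2 i1, (i0 <= i1)%N & forall i, (i1 <= i)%N -> u i <= k / rho + e.
Proof.
move=> /andP[r0 r1] e0 hu; pose w := `|u i0 - k / rho| + 1.
have w0 : 0 < w by rewrite ltr_wpDl.
have q0 : 0 <= 1 - rho by rewrite subr_ge0.
have hw j : u (i0 + j)%N - k / rho <= (1 - rho) ^+ j * w.
  elim: j => [|j IH].
    by rewrite addn0 expr0 mul1r (le_trans (ler_norm _)) // lerDl.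
  rewrite addnS exprS -mulrA; apply: le_trans (ler_wpM2l q0 IH).
  have := hu (i0 + j)%N (leq_addr _ _).
  have : k / rho * rho = k by rewrite divfK // gt_eqF.
  by move: (k / rho) => y; lra.
have cv : (fun j => (1 - rho) ^+ j : R) @ \oo --> 0.
  by apply: cvg_expr; rewrite ger0_norm //; lra.
have ew : 0 < e / w by rewrite divr_gt0.
have [j _ hj] := cvgr0_norm_lt _ cv _ ew.
exists (i0 + j)%N; first exact: leq_addr.
move=> i hi; have ji : (j <= i - i0)%N by rewrite leq_subRL // (leq_trans (leq_addr j i0)).
have := hw (i - i0)%N; rewrite subnKC ?(leq_trans (leq_addr j i0)) //.
have := hj _ ji; rewrite /= ger0_norm ?exprn_ge0 // ltr_pdivlMr //.
by lra.
Qed.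

(** The disagreement [b] contracts at a rate independent of [mu], the centroid [a] at
a rate of order [mu].  With the weight [2 * D / dl] on [b], the contraction of [b] pays
for its leakage into [a], so the weighted sum contracts at rate [mu * l / 2] under a
forcing of order [mu] and ends up bounded.  Knowing this, the recursion of [b] alone has
forcing of order [mu ^+ 2]. *)
Lemma two_timescale (D l dl : R) : 0 < D -> 0 < l -> 0 < dl <= 1 ->
  exists mu0 B : R, [/\ 0 < mu0, mu0 <= 1, 0 < B & forall mu, 0 < mu <= mu0 ->
    forall a b : nat -> R,
    (forall i, 0 <= a i) -> (forall i, 0 <= b i) ->
    (forall i, b i.+1 <= (1 - dl) * b i + D * mu ^+ 2 * (1 + a i + b i)) ->
    (forall i, a i.+1 <= (1 - mu * l) * a i + D * b i + D * mu
                 + D * mu ^+ 2 * (1 + a i + b i)) ->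
    exists i0, forall i, (i0 <= i)%N -> a i <= B /\ b i <= B * mu ^+ 2].
Proof.
move=> D0 l0 /andP[dl0 dl1].
have [Lam LamE] : {Lam | Lam = 2 * D / dl} by eexists.
have Lam0 : 0 < Lam by rewrite LamE divr_gt0 // mulr_gt0.
have LamD : Lam * dl = 2 * D by rewrite LamE divfK // gt_eqF.
have [E EE] : {E | E = (1 + Lam) * D} by eexists.
have E0 : 0 < E by rewrite EE mulr_gt0 // addr_gt0.
have [B1 B1E] : {B1 | B1 = 2 * (D + E) / l + 1} by eexists.
have [B2 B2E] : {B2 | B2 = 1 + B1 + B1 / Lam} by eexists.
have B10 : 0 < B1 by rewrite B1E ltr_wpDl // divr_ge0 ?mulr_ge0 ?addr_ge0 // ltW.
have B20 : 0 < B2 by rewrite B2E !addr_gt0 // divr_gt0.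
have c1 : 0 < l / (2 * E) by rewrite divr_gt0 // mulr_gt0.
have c2 : 0 < D / (E + Lam * l) by rewrite divr_gt0 // addr_gt0 // mulr_gt0.
have c3 : 0 < l^-1 by rewrite invr_gt0.
(* The four bounds on [mu] give, in this order: [mu ^+ 2 <= mu]; the quadratic forcing
   uses up at most half of the contraction of [a]; what the contraction of [b] leaves after
   its leakage, [D * b], covers the forcing and the rate [mu * l / 2]; and [1 - mu * l / 2] is nonnegative. *)
exists (Num.min 1 (Num.min (l / (2 * E)) (Num.min (D / (E + Lam * l)) l^-1))).
exists (B1 + (D * B2 / dl + 1)); split.
- by rewrite !lt_min c1 c2 c3 ltr01.
- by rewrite ge_min lexx.
- by rewrite !addr_gt0 // divr_gt0 // mulr_gt0.
move=> mu /andP[mu0]; rewrite !le_min => /and4P[m1 m2 m3 m4] a b a0 b0 hb ha.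
have {}m2 : 2 * E * mu <= l by move: m2; rewrite ler_pdivlMr ?mulr_gt0 // mulrC.
have {}m3 : (E + Lam * l) * mu <= D.
  by move: m3; rewrite ler_pdivlMr ?addr_gt0 ?mulr_gt0 // mulrC.
have {}m4 : mu * l <= 1 by rewrite -ler_pdivlMr // mul1r.
pose S i := a i + Lam * b i.
have hS i : S i.+1 <= (1 - mu * l / 2) * S i + (D + E) * mu.
  have A0 := a0 i; have Bi0 := b0 i.
  have hLb : Lam * b i.+1 <= Lam * ((1 - dl) * b i + D * mu ^+ 2 * (1 + a i + b i)).
    by rewrite ler_wpM2l // ltW.
  have hai := ha i; rewrite /S.
  have e1 : Lam * ((1 - dl) * b i + D * mu ^+ 2 * (1 + a i + b i)) =
     Lam * b i - (Lam * dl) * b i + (Lam * D) * (mu ^+ 2 * (1 + a i + b i)) by ring.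
  rewrite e1 LamD in hLb.
  have e2 : E * (mu ^+ 2 * (1 + a i + b i)) =
     D * mu ^+ 2 * (1 + a i + b i) + Lam * D * (mu ^+ 2 * (1 + a i + b i)).
    by rewrite EE; ring.
  have e3 : 2 * E * (mu ^+ 2 * a i) <= l * mu * a i.
    have := ler_wpM2r (mulr_ge0 (ltW mu0) A0) m2.
    by rewrite -[X in X <= _ -> _]mulrA; lra.
  have e4 : E * (mu ^+ 2 * b i) + Lam * l * mu * b i <= D * b i.
    have h1 := ler_wpM2r Bi0 m3.
    have h2 : E * (mu ^+ 2 * b i) <= E * (mu * b i).
      rewrite ler_wpM2l ?(ltW E0) // ler_wpM2r // expr2 ler_piMr // ltW //.
    by lra.
  have e5 : E * mu ^+ 2 <= E * mu.
    by rewrite ler_wpM2l ?(ltW E0) // expr2 ler_piMr // ltW.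
  have e6 : 0 <= Lam * l * mu * b i by rewrite !mulr_ge0 // ltW.
  by lra.
have [||i1 _ h1] := @contraction_eventually S (mu * l / 2) ((D + E) * mu) 1 0 _ ltr01.
- apply/andP; split; first by rewrite divr_gt0 // mulr_gt0.
  by lra.
- by move=> i _; apply: hS.
have SB i : (i1 <= i)%N -> S i <= B1.
  move=> hi; apply: le_trans (h1 i hi) _; rewrite B1E lerD2r.
  rewrite le_eqVlt; apply/orP; left; apply/eqP; field.
  by rewrite !gt_eqF.
have aB i : (i1 <= i)%N -> a i <= B1.
  move/SB; apply: le_trans; by rewrite lerDl mulr_ge0 // ltW.
have bB i : (i1 <= i)%N -> b i <= B1 / Lam.
  move/SB => h; rewrite ler_pdivlMr // mulrC; apply: le_trans h.
  by rewrite lerDr.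
have m20 : 0 < mu ^+ 2 by rewrite exprn_gt0.
have [||i2 i12 h2] := @contraction_eventually b dl (D * B2 * mu ^+ 2) (mu ^+ 2) i1 _ m20.
- by rewrite dl0.
- move=> i hi; apply: le_trans (hb i) _; rewrite lerD2l.
  rewrite mulrAC ler_wpM2r ?(ltW m20) // ler_wpM2l ?(ltW D0) //.
  by have := aB i hi; have := bB i hi; rewrite B2E; lra.
exists i2 => i hi; split.
  apply: le_trans (aB i (leq_trans i12 hi)) _.
  by rewrite lerDl addr_ge0 // divr_ge0 ?mulr_ge0 // ltW.
apply: le_trans (h2 i hi) _.
have -> : D * B2 * mu ^+ 2 / dl + mu ^+ 2 = (D * B2 / dl + 1) * mu ^+ 2 by ring.
by rewrite ler_wpM2r ?(ltW m20) // lerDr ltW.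
Qed.

End SequenceBounds.

Section MeanSquareBound.
Variable R : realType.

(** Substituting the bounds on the quantizer input and on the quantization error
into the two moment recursions, the noise fed back into [b] costs [2 * v * bq * q], less
than [dl / 2], and Young's inequality with parameter [dl / 4] costs another [dl / 4]; a
contraction by [1 - dl / 4] remains, and [two_timescale] applies. *)
Lemma moments_eventually_small (v q bq Cg C s dl l : R) :
  0 <= v -> 0 <= q -> 0 <= bq -> 0 <= Cg -> 0 <= C -> 0 <= s ->
  0 < dl <= 1 -> 4 * v * bq * q < dl -> 0 < l ->
  exists mu0 B : R, [/\ 0 < mu0, 0 < B & forall mu, 0 < mu <= mu0 ->
    forall a b c z g : nat -> R,
    (forall i, 0 <= a i) -> (forall i, 0 <= b i) ->
    (forall i, (0 < i)%N ->
    [/\ g i <= Cg * (1 + a i.-1 + b i.-1),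
        c i <= 2 * q * b i.-1 + 2 * mu ^+ 2 * g i,
        z i <= bq * c i + s * mu ^+ 2,
        forall r, 0 < r -> b i <= (1 + r) * (1 - dl) * b i.-1
           + (1 + r^-1) * mu ^+ 2 * v * g i + v * z i &
        a i <= a i.-1 + mu * (- l * a i.-1 + C * (1 + b i.-1))
           + mu ^+ 2 * v * g i + v * z i]) ->
    exists i0, forall i, (i0 <= i)%N -> c i <= B * mu ^+ 2 /\ z i <= B * mu ^+ 2].
Proof.
move=> v0 q0 bq0 Cg0 C0 s0 /andP[dl0 dl1] hdl l0.
have [D1 D1E] : {D1 | D1 = 2 * bq * Cg + s} by eexists.
have bC : 0 <= bq * Cg by rewrite mulr_ge0.
have D10 : 0 <= D1 by rewrite D1E; lra.
have vD : 0 <= v * D1 by rewrite mulr_ge0.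
have vC : 0 <= v * Cg by rewrite mulr_ge0.
have [e eE] : {e | e = (dl / 4)^-1} by eexists.
have e0 : 0 < e by rewrite eE invr_gt0 divr_gt0.
have evC : 0 <= e * (v * Cg) by rewrite mulr_ge0 // ltW.
have [D DE] : {D | D = 1 + C + (1 + e) * (v * Cg) + v * D1 + dl / 2} by eexists.
have D0 : 0 < D by rewrite DE; lra.
have dl4 : 0 < dl / 4 <= 1 by apply/andP; split; lra.
have [mu0 [B [mu00 mu01 B0 HB]]] := two_timescale D0 l0 dl4.
pose Bc := 2 * q * B + 2 * (Cg * (1 + B + B)).
have qB : 0 <= q * B by rewrite mulr_ge0 // ltW.
have Bc0 : 0 <= Bc.
  have : 0 <= Cg * (1 + B + B) by rewrite mulr_ge0 //; lra.
  by rewrite /Bc; lra.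
exists mu0, (Bc + (bq * Bc + s) + 1); split => //.
  by have := mulr_ge0 bq0 Bc0; lra.
move=> mu /andP[m0 m1] a b c z g a0 b0 hM.
have mu1 : mu <= 1 by apply: le_trans m1 mu01.
have m20 : 0 <= mu ^+ 2 by apply: sqr_ge0.
have m21 : mu ^+ 2 <= 1 by rewrite expr2 mulr_ile1 // ltW.
pose V i := 1 + a i + b i.
have V1 i : 1 <= V i by rewrite /V -addrA lerDl addr_ge0.
have cV i : c i.+1 <= 2 * q * b i + 2 * Cg * (mu ^+ 2 * V i).
  have [hg hc _ _ _] := hM i.+1 isT; apply: le_trans hc _; rewrite lerD2l /=.
  have := ler_wpM2l m20 hg; rewrite /= -/(V i).
  by lra.
have zV i : z i.+1 <= 2 * (bq * q) * b i + D1 * (mu ^+ 2 * V i).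
  have [_ _ hz _ _] := hM i.+1 isT; apply: le_trans hz _.
  have h1 := ler_wpM2l bq0 (cV i).
  have h2 : s * mu ^+ 2 <= s * (mu ^+ 2 * V i).
    by rewrite ler_wpM2l // ler_peMr.
  by rewrite D1E; lra.
have vzV i : v * z i.+1 <= dl / 2 * b i + v * D1 * (mu ^+ 2 * V i).
  have h1 := ler_wpM2l v0 (zV i).
  have h2 := ler_wpM2r (b0 i) (ltW hdl).
  by lra.
have gV i : mu ^+ 2 * v * g i.+1 <= v * Cg * (mu ^+ 2 * V i).
  have [hg _ _ _ _] := hM i.+1 isT.
  have := ler_wpM2l (mulr_ge0 m20 v0) hg; rewrite /= -/(V i); lra.
have mV0 i : 0 <= mu ^+ 2 * V i by rewrite mulr_ge0 // (le_trans ler01).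
have [|||i0 hi0] := HB mu _ a b a0 b0.
- by rewrite m0.
- move=> i; have [_ _ _ hb _] := hM i.+1 isT.
  have h1 := hb (dl / 4) ltac:(lra); rewrite -eE /= in h1.
  have h2 : e * (mu ^+ 2 * v * g i.+1) <= e * (v * Cg * (mu ^+ 2 * V i)).
    by rewrite ler_wpM2l // ltW.
  have h3 : (1 + dl / 4) * (1 - dl) * b i <= (1 - 3 / 4 * dl) * b i.
    by rewrite ler_wpM2r //; nra.
  have h4 : ((1 + e) * (v * Cg) + v * D1) * (mu ^+ 2 * V i) <= D * (mu ^+ 2 * V i).
    by rewrite ler_wpM2r // DE; lra.
  rewrite -mulrA -/(V i).
  by have := vzV i; have := gV i; lra.
- move=> i; have [_ _ _ _ ha] := hM i.+1 isT; rewrite /= in ha.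
  have h1 : C * mu * b i <= C * b i.
    by rewrite ler_wpM2r // ler_piMr.
  have h2 : (C + dl / 2) * b i <= D * b i by rewrite ler_wpM2r // DE; lra.
  have h3 : C * mu <= D * mu by rewrite ler_wpM2r ?(ltW m0) // DE; lra.
  have h4 : (v * Cg + v * D1) * (mu ^+ 2 * V i) <= D * (mu ^+ 2 * V i).
    by rewrite ler_wpM2r // DE; lra.
  rewrite -[X in _ <= _ + X]mulrA -/(V i).
  by have := vzV i; have := gV i; lra.
exists i0.+1 => i; case: i => // i; rewrite ltnS => hi.
have [ha hb] := hi0 i hi.
have cB : c i.+1 <= Bc * mu ^+ 2.
  apply: le_trans (cV i) _.
  have h1 : q * b i <= q * (B * mu ^+ 2) by rewrite ler_wpM2l.
  have h2 : b i <= B by apply: le_trans hb _; rewrite ler_piMr // ltW.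
  have h3 : Cg * mu ^+ 2 * V i <= Cg * mu ^+ 2 * (1 + B + B).
    by rewrite ler_wpM2l ?mulr_ge0 // /V; lra.
  by rewrite /Bc; lra.
have zB : z i.+1 <= (bq * Bc + s) * mu ^+ 2.
  have [_ _ hz _ _] := hM i.+1 isT; apply: le_trans hz _.
  by have := ler_wpM2l bq0 cB; lra.
have h1 : 0 <= Bc * mu ^+ 2 by rewrite mulr_ge0.
have h2 : 0 <= (bq * Bc + s) * mu ^+ 2 by rewrite mulr_ge0 // addr_ge0 // mulr_ge0.
by split; lra.
Qed.

End MeanSquareBound.

(** * Quantization levels and code lengths *)

Section BitBounds.
Variable R : realType.

Lemma growth_base_gt1 (omega : R) : 0 < omega ->
  1 < omega + Num.sqrt (1 + omega ^+ 2).
Proof.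
move=> o0; rewrite ltr_pwDl // -[X in X <= _]sqrtr1 ler_wsqrtr // lerDl sqr_ge0.
by [].
Qed.

(** The levels grow exponentially in the index; the tangent line [1 + x] of the
exponential already gives linear growth, with slope proportional to [eta]. *)
Lemma qlevel_growth (omega eta : R) (z : int) : 0 < omega -> 0 < eta ->
  `|z%:~R| <= omega / (2 * ln (omega + Num.sqrt (1 + omega ^+ 2))) *
              (`|qlevel (nl_h omega eta) z| / eta).
Proof.
move=> o0 e0; have t1 := growth_base_gt1 o0; rewrite /qlevel /nl_h.
move: (omega + _) t1 => tau t1; have l0 : 0 < ln tau by rewrite ln_gt0.
have [->|z0] := eqVneq z 0.
  rewrite mulr0z normr0 mulr_ge0 ?divr_ge0 ?(ltW o0) ?(ltW e0) //.
  by rewrite mulr_ge0 // ltW.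
set y := `|z%:~R|; have y0 : 0 <= y by apply: normr_ge0.
have p1 : 2 * y * ln tau <= tau `^ (2 * y) - 1.
  rewrite /powR gt_eqF ?(lt_trans ltr01) // lerBrDl; exact: expR_ge1Dx.
have -> : `|Num.sg z%:~R * (eta / omega * (tau `^ (2 * y) - 1))| =
    eta / omega * (tau `^ (2 * y) - 1).
  have p0 : 0 <= tau `^ (2 * y) - 1.
    by apply: le_trans p1; rewrite !mulr_ge0 // ltW.
  rewrite normrM normr_sg intr_eq0 z0 mul1r ger0_norm //.
  by rewrite mulr_ge0 // divr_ge0 // ltW.
have -> : omega / (2 * ln tau) * (eta / omega * (tau `^ (2 * y) - 1) / eta) =
    (tau `^ (2 * y) - 1) / (2 * ln tau).
  by field; rewrite !gt_eqF.
by rewrite ler_pdivlMr ?mulr_gt0 // mulrCA mulrA.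
Qed.

Definition code_length (z : int) : R :=
  (Num.ceil (log2 (`|z|%N%:R + 1 : R)))%:~R.

Lemma ln2_gt0 : 0 < ln 2 :> R.
Proof. by apply: ln_gt0; rewrite ltr1n. Qed.

Lemma code_length_ge0 z : 0 <= code_length z.
Proof.
rewrite ler0z ceil_ge0; apply: (lt_le_trans (ltrN10 R)).
by rewrite divr_ge0 ?ln_ge0 ?(ltW ln2_gt0) // lerDr.
Qed.

(** A code length is logarithmic in the index, and the logarithm lies below its
tangent. *)
Lemma code_length_le z : code_length z <= 1 + `|z%:~R| / ln 2.
Proof.
have h := ceilB1_lt (log2 (`|z|%N%:R + 1 : R)).
rewrite intrB -/(code_length z) in h; rewrite -lerBlDl ltW //.
apply: lt_le_trans h _; rewrite /log2 ler_wpM2r ?invr_ge0 ?(ltW ln2_gt0) //.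
rewrite natr_absz -intr_norm addrC; apply: le_ln1Dx.
by apply: lt_le_trans (ltrN10 R) _.
Qed.

Definition bit_constant (omega : R) : R :=
  omega / (2 * ln (omega + Num.sqrt (1 + omega ^+ 2))) / ln 2.

Lemma bit_constant_ge0 omega : 0 < omega -> 0 <= bit_constant omega.
Proof.
move=> o0; rewrite !divr_ge0 ?(ltW ln2_gt0) ?(ltW o0) // mulr_ge0 //.
by rewrite ltW // ln_gt0 // growth_base_gt1.
Qed.

(** A second moment is at hand rather than a first one, hence the bound of
[x] by [1 + x ^+ 2] at [x] the level in units of [eta]. *)
Lemma code_length_le_level (omega eta : R) z : 0 < omega -> 0 < eta ->
  code_length z <=
  1 + bit_constant omega * (1 + qlevel (nl_h omega eta) z ^+ 2 / eta ^+ 2).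
Proof.
move=> o0 e0; apply: le_trans (code_length_le z) _; rewrite lerD2l.
have h := qlevel_growth z o0 e0; set y := qlevel _ _ in h *.
have y1 : `|y| / eta <= 1 + y ^+ 2 / eta ^+ 2.
  rewrite -(real_normK (num_real y)) -expr_div_n.
  by move: (`|y| / eta) => x; nra.
rewrite ler_pdivrMr ?ln2_gt0 //; apply: le_trans h _.
rewrite /bit_constant [X in _ <= X]mulrAC divfK ?gt_eqF ?ln2_gt0 // ler_wpM2l //.
rewrite divr_ge0 ?(ltW o0) // mulr_ge0 //.
by rewrite ltW // ln_gt0 // growth_base_gt1.
Qed.

Lemma log2_3_gt0 : 0 < log2 (3 : R).
Proof. by rewrite divr_gt0 ?ln2_gt0 // ln_gt0 // ltr1n. Qed.

Lemma limn_esup_le (u : nat -> \bar R) (C : \bar R) (i0 : nat) :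
  (forall i, (i0 <= i)%N -> (u i <= C)%E) -> (limn_esup u <= C)%E.
Proof.
move=> h; rewrite limn_esup_lim; apply: lime_le; first exact: is_cvg_esups.
exists i0 => // i /= hi; apply: ge_ereal_sup => _ [j /= ij <-].
by apply: h; apply: leq_trans hi ij.
Qed.

Section Rate.
Context {d : measure_display} {T : measurableType d}.
Variable Pr : probability T R.
Variables (N : nat) (M : 'I_N -> nat) (X : trajectory R M T).
Variable h : 'I_N -> R -> R.
Variables (k : 'I_N) (i : nat) (omega eta : R).
Hypotheses (omega_gt0 : 0 < omega) (eta_gt0 : 0 < eta).
Hypothesis hk : h k = nl_h omega eta.
Hypothesis idx_meas : forall (j : 'I_(M k)) z, measurable [set t | idx X i j t = z].
Hypothesis hc : vL2 Pr (qinput X i).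
Hypothesis hz : vL2 Pr (qerr X h i).

(** The quantizer output is its input minus the quantization error. *)
Lemma qlevel_sqr_le (j : 'I_(M k)) t :
  qlevel (nl_h omega eta) (idx X i j t) ^+ 2 <=
  2 * sqn (qinput X i t) + 2 * sqn (qerr X h i t).
Proof.
pose p := tagnat.Rank k j.
have e : qlevel (nl_h omega eta) (idx X i j t) =
    qinput X i t p 0 - qerr X h i t p 0.
  have -> : qinput X i t p 0 = submxcol (qinput X i t) k j 0 by rewrite [RHS]mxE.
  have -> : qerr X h i t p 0 = submxcol (qerr X h i t) k j 0 by rewrite [RHS]mxE.
  rewrite !mxcolK /quant_error; move: (chi X k i t) => w.
  rewrite /quantized !mxE hk.
  by rewrite opprB addrCA subrr addr0.
apply: (@le_trans _ _ (sqn (qinput X i t - qerr X h i t))); last exact: sqnB_le.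
rewrite e /sqn (bigD1 p) //= !mxE lerDl; apply: sumr_ge0 => a _; exact: sqr_ge0.
Qed.

Lemma expected_code_length_le (j : 'I_(M k)) (B : R) :
  Ex Pr (fun t => sqn (qinput X i t)) <= B * eta ^+ 2 ->
  Ex Pr (fun t => sqn (qerr X h i t)) <= B * eta ^+ 2 ->
  ('E_Pr[fun t => code_length (idx X i j t)] <=
     (1 + bit_constant omega * (1 + 4 * B))%:E)%E.
Proof.
move=> hB1 hB2; rewrite unlock.
have ic := intg_sqn hc; have iz := intg_sqn hz.
pose kap := bit_constant omega; have k0 : 0 <= kap := bit_constant_ge0 omega_gt0.
have e20 : 0 < eta ^+ 2 by rewrite exprn_gt0.
pose c1 := kap * (2 / eta ^+ 2).
have c10 : 0 <= c1 by rewrite mulr_ge0 // divr_ge0 // ltW.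
pose f t := 1 + kap + c1 * (sqn (qinput X i t) + sqn (qerr X h i t)).
have i1 := intgZ c1 (intgD ic iz).
have ifn : intg Pr f by apply: intgD => //; exact: intg_cst.
apply: (@le_trans _ _ (\int[Pr]_t (f t)%:E)%E).
  apply: ge0_le_integral => //.
  - by move=> t _; rewrite lee_fin code_length_ge0.
  - apply/measurable_EFinP.
    apply: (measurable_countable_fun code_length (c := idx X i j)) => z.
    exact: idx_meas.
  - by apply: measurable_int ifn.
  - move=> t _; rewrite lee_fin; apply: le_trans (code_length_le_level _ omega_gt0 eta_gt0) _.
    rewrite -/kap /f -addrA lerD2l mulrDr mulr1 lerD2l /c1 -mulrA ler_wpM2l //.
    rewrite ler_pdivrMr // mulrAC divfK ?gt_eqF // mulrDr.
    exact: qlevel_sqr_le.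
rewrite EFin_Ex // lee_fin (ExD (intg_cst Pr (1 + kap)) i1) (ExZ _ (intgD ic iz)).
rewrite (ExD ic iz) Ex_cst.
rewrite -addrA lerD2l [X in _ <= X]mulrDr mulr1 lerD2l /c1 -mulrA ler_wpM2l //.
by rewrite mulrAC ler_pdivrMr //; lra.
Qed.

Lemma bit_rate_le (B : R) :
  Ex Pr (fun t => sqn (qinput X i t)) <= B * eta ^+ 2 ->
  Ex Pr (fun t => sqn (qerr X h i t)) <= B * eta ^+ 2 ->
  (bit_rate Pr X k i <=
   (log2 3 * \sum_(j < M k) (1 + (1 + bit_constant omega * (1 + 4 * B))))%:E)%E.
Proof.
move=> hB1 hB2; rewrite /bit_rate [X in (_ <= X)%E]EFinM; apply: lee_wpmul2l.
  by rewrite lee_fin ltW // log2_3_gt0.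
rewrite -sumEFin; apply: lee_sum => j _; rewrite EFinD; apply: leeD => //.
exact: expected_code_length_le.
Qed.
End Rate.
End BitBounds.

(** * The steady-state bit rate *)

Unset Implicit Arguments.
Set Strict Implicit.

Theorem theorem2 (R : realType) (N P : nat) (M : 'I_N -> nat)
  (M_gt0 : forall k, (0 < M k)%N)
  (P_range : (0 < P < \sum_k M k)%N)
  (* costs, subspace constraint and combination matrix *)
  (J : forall k : 'I_N, 'cV[R]_(M k) -> R)
  (U : 'M[R]_(\sum_k M k, P))
  (lk_min lk_max : 'I_N -> R) (l_min l_max : R)
  (costs : cost_assumption J U lk_min lk_max l_min l_max)
  (wo : 'cV[R]_(\sum_k M k)) (wo_min : is_unique_minimizer J U wo)
  (Nb : 'I_N -> {set 'I_N}) (A : 'M[R]_(\sum_k M k))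
  (comb : combination_assumption U Nb A)
  (* quantizer parameters: omega is the constant c, eta scales with mu *)
  (alpha : R) (alpha01 : 0 < alpha < 1)
  (omega : 'I_N -> R) (omega_gt0 : forall k, 0 < omega k)
  (eta : 'I_N -> R -> R) (eta_propto : forall k, propto (eta k) id)
  (* Jordan decomposition and mixing parameter *)
  (B : nat) (lam : 'I_B -> complex R) (sz : 'I_B -> nat)
  (VR VL : 'M[complex R]_(\sum_k M k, \sum_b sz b)) (eps : R)
  (jordan : jordan_decomposition U lam VR VL eps A)
  (gamma : R)
  (gamma_range : 0 < gamma < gamma_bound U lam VR VL eps
      (\big[Num.max/0]_k beta_q2 alpha (omega k)))
  (* gradient noise parameters *)
  (bs2 ss2 : 'I_N -> R)
  (* one run of the strategy for every step-size mu *)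
  (d : R -> measure_display) (T : forall mu : R, measurableType (d mu))
  (Pr : forall mu : R, probability (T mu) R)
  (X : forall mu : R, trajectory R M (T mu))
  (strategy : forall mu : R, 0 < mu ->
     strategyQ (Pr mu) Nb A (X mu) mu gamma
       (fun k => nl_h (omega k) (eta k mu)))
  (noise : forall mu : R, 0 < mu ->
     gradient_noise_assumption (Pr mu) J wo (X mu) bs2 ss2)
  (quantizer : forall mu : R, 0 < mu ->
     randomized_quantizer (Pr mu) (X mu)
       (fun k => nl_g (omega k) (eta k mu))
       (fun k => nl_h (omega k) (eta k mu)))
  (mechanism : forall mu : R, 0 < mu ->
     quantization_mechanism (Pr mu) (X mu)
       (fun k => nl_h (omega k) (eta k mu))
       (fun k => beta_q2 alpha (omega k))
       (fun k => sigma_q2 alpha (M k) (eta k mu))) :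
  (forall k, propto (fun mu => sigma_q2 alpha (M k) (eta k mu))
                    (fun mu => mu ^+ 2))
  /\
  (forall k, exists C mu0 : R, [/\ 0 < C, 0 < mu0 &
     forall mu : R, 0 < mu <= mu0 ->
       (limn_esup (fun i => bit_rate (Pr mu) (X mu) k i) <= C%:E)%E]).
Proof.
have eta1 k mu : 0 < mu -> eta k mu = eta k 1 * mu.
  move=> mu0; have [c _ hc] := eta_propto k.
  by rewrite (hc mu) // (hc 1) // mulr1.
have eta1_gt0 k : 0 < eta k 1.
  by have [c c0 hc] := eta_propto k; rewrite (hc 1) // mulr1.
have [al0 al1] := andP alpha01; have al10 : 0 < 1 - alpha by rewrite subr_gt0.
have sigmaE k mu : 0 < mu ->
    sigma_q2 alpha (M k) (eta k mu) = sigma_q2 alpha (M k) (eta k 1) * mu ^+ 2.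
  by move=> mu0; rewrite /sigma_q2 eta1 // exprMn mulrA mulrAC.
have sigma1_gt0 k : 0 < sigma_q2 alpha (M k) (eta k 1).
  by rewrite divr_gt0 // mulr_gt0 ?ltr0n // exprn_gt0.
split=> [k|].
  by exists (sigma_q2 alpha (M k) (eta k 1)) => // mu mu0; apply: sigmaE.
(* The quantization noise parameter of the network: the worst agent. *)
pose bq := \big[Num.max/0]_k beta_q2 alpha (omega k).
have beta_ge0 k : 0 <= beta_q2 alpha (omega k).
  by rewrite divr_ge0 ?sqr_ge0 // ltW.
have beta_le k : beta_q2 alpha (omega k) <= bq by rewrite /bq (bigD1 k) //= le_max lexx.
have bq0 : 0 <= bq by apply: bigmax_ge_id.
have [m [K [v [q [r [dl [[dl01 [v0 q0 r0] hdl] [KW Kv Uv Kq Kr]]]]]]]] :=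
  mixing_estimates jordan bq0 gamma_range.
have [L L0 lip] := grad_stack_lipschitz costs.
have [C C0 drift] := drift_estimates costs (comb_orth comb) wo q0 r0 Kq Kr.
have l0 : 0 < l_min by case/andP: (cost_global_gt0 costs).
have wo_range : in_range U wo by case: wo_min => [[]].
pose s := \sum_k sigma_q2 alpha (M k) (eta k 1).
have s0 : 0 <= s by apply: sumr_ge0 => k _; exact: ltW.
have g0 : 0 <= \sum_k bs2 k /\ 0 <= \sum_k ss2 k.
  by have := noise 1 ltr01 => gn; split; apply: sumr_ge0 => k _; have [] := gn_ge0 gn k.
pose Cg := 2 * C + 2 * (\sum_k bs2 k) * C + 2 * \sum_k ss2 k.
have Cg0 : 0 <= Cg.
  by have [h1 h2] := g0; have := mulr_ge0 h1 C0; rewrite /Cg; lra.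
have [mu0 [B0 [mu00 B00 HB]]] :=
  moments_eventually_small v0 q0 bq0 Cg0 C0 s0 dl01 hdl l0.
move=> k.
(* [B' * eta ^+ 2 = B0 * mu ^+ 2]: the moment bound in units of the resolution [eta]. *)
pose B' := B0 / eta k 1 ^+ 2.
have B'0 : 0 < B' by rewrite divr_gt0 // exprn_gt0.
exists (log2 3 * \sum_(j < M k) (1 + (1 + bit_constant (omega k) * (1 + 4 * B')))), mu0.
have kap0 := bit_constant_ge0 (omega_gt0 k).
split => //.
  rewrite mulr_gt0 ?log2_3_gt0 // sumr_const card_ord mulrn_wgt0 //.
  have : 0 <= bit_constant (omega k) * (1 + 4 * B') by rewrite mulr_ge0 //; lra.
  by lra.
move=> mu mu_range; have [mu_gt0 _] := andP mu_range.
pose hh k := nl_h (omega k) (eta k mu).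
have st := strategy mu mu_gt0; have gn := noise mu mu_gt0.
have qm := mechanism mu mu_gt0; have rq := quantizer mu mu_gt0.
have sq0 l : 0 <= sigma_q2 alpha (M l) (eta l mu).
  by rewrite sigmaE // mulr_ge0 ?sqr_ge0 // ltW.
have [|||i0 hi0] := HB mu mu_range
  (centroid_moment (Pr mu) U wo (X mu)) (disagreement_moment (Pr mu) wo (X mu) K)
  (input_moment (Pr mu) (X mu)) (qerr_second_moment (Pr mu) (X mu) hh)
  (grad_second_moment (Pr mu) (X mu)).
- by move=> i; apply: Ex_ge0 => t; apply: sqn_ge0.
- by move=> i; apply: Ex_ge0 => t; apply: sqn_ge0.
- move=> i hi; split.
  + exact: (grad_moment_le comb st wo_range gn qm beta_ge0 sq0 lip C0 drift hi).
  + exact: (input_moment_le comb st wo_range gn qm beta_ge0 sq0 lip Kq hi).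
  + have := qerr_moment_le comb st wo_range gn qm beta_ge0 sq0 lip beta_le hi.
    suff -> : \sum_l sigma_q2 alpha (M l) (eta l mu) = s * mu ^+ 2 by [].
    by rewrite mulr_suml; apply: eq_bigr => l _; exact: sigmaE.
  + move=> e e0.
    exact: (disagreement_moment_le comb st wo_range gn qm beta_ge0 sq0 lip mu_gt0 KW Kv e0 hi).
  + exact: (centroid_moment_le comb st wo_range gn qm beta_ge0 sq0 lip mu_gt0 Uv drift hi).
apply: (@limn_esup_le _ _ _ i0.+1) => i hi.
have i_gt0 : (0 < i)%N by apply: leq_ltn_trans hi.
have hx j := vL2_phi_error comb st wo_range gn qm beta_ge0 sq0 lip j.
have [hc hz] := hi0 i (ltnW hi).
have eta_gt0 : 0 < eta k mu by rewrite eta1 // mulr_gt0.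
have Beta : B' * eta k mu ^+ 2 = B0 * mu ^+ 2.
  by rewrite /B' (eta1 k mu) // exprMn mulrA divfK // gt_eqF // exprn_gt0.
apply: (bit_rate_le (h := hh) (omega_gt0 k) eta_gt0 erefl).
- by move=> j z; apply: (rq_meas rq).
- exact: (vL2_qinput comb st wo_range gn lip i_gt0 (hx i.-1)).
- by have [] := qerr_moment comb st wo_range gn qm beta_ge0 sq0 lip i_gt0 (fun j _ => hx j).
- by rewrite Beta.
- by rewrite Beta.
Qed.
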